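(* The following decision problem is NP-complete: given a graph $G$ and an integer $p\ge 3$, decide whether $G$ has an m-convex $p$-cover.
   Context: Graphs are finite, undirected, without loops or multiple edges. A path is induced if no edge joins two nonconsecutive vertices of the path. A set $S\subseteq V(G)$ is m-convex (monophonically convex) if for every induced path of $G$ whose two end-vertices belong to $S$, all vertices of the path belong to $S$. An m-convex $p$-cover of $G$ is a family $V_1,\ldots,V_p$ (repetitions and empty sets allowed) of $p$ m-convex sets, each different from $V(G)$, such that $V_1\cup\cdots\cup V_p=V(G)$. *)

(* Defs.v *)
From HB Require Import structures.
From mathcomp Require Import all_boot all_order all_algebra.

Set Implicit Arguments.
Unset Strict Implicit.
Unset Printing Implicit Defensive.

Import GRing.Theory.

(** * Monophonic convexity *)

Section MonophonicConvexity.

Variables (T : finType) (e : rel T).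

(* [x :: s] lists the vertices of the path in order. *)
Definition induced_path (x : T) (s : seq T) : Prop :=
  [/\ path e x s, uniq (x :: s) &
      forall i j : nat, i.+1 < j -> j < size (x :: s) ->
        ~~ e (nth x (x :: s) i) (nth x (x :: s) j)].

Definition m_convex (S : {set T}) : Prop :=
  forall (x : T) (s : seq T), induced_path x s ->
    x \in S -> last x s \in S -> {subset x :: s <= S}.

Definition has_m_convex_cover (p : nat) : Prop :=
  exists V : 'I_p -> {set T},
    [/\ forall i, m_convex (V i),
        forall i, V i != [set: T] &
        \bigcup_(i < p) V i = [set: T]].

End MonophonicConvexity.

(** * Deterministic multitape Turing machines *)

Definition word := seq bool.

Inductive direction := Left | Stay | Right.

(* [None] is the blank, [Some (inl b)] an input/output bit, and [Some (inr a)]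
   an auxiliary symbol of the machine. *)
Definition symbol (A : finType) : finType := option (bool + A)%type.

(* There are [tm_tapes.+2] tapes, so that a machine with two inputs always has
   a tape for each of them. A transition to [None] means that the machine
   halts. *)
Record turing_machine := TuringMachine {
  tm_tapes : nat;
  tm_state : finType;
  tm_aux : finType;
  tm_start : tm_state;
  tm_accept : pred tm_state;
  tm_delta : tm_state -> {ffun 'I_tm_tapes.+2 -> symbol tm_aux} ->
    option (tm_state * ('I_tm_tapes.+2 -> symbol tm_aux * direction)) }.

(* A two-way infinite tape: [tape_left] lists the cells to the left of the head,
   nearest first, and [tape_right] the scanned cell followed by the cells to
   its right; all cells not listed are blank. *)
Record tape (A : finType) := Tape {
  tape_left : seq (symbol A);
  tape_right : seq (symbol A) }.

Section Tapes.

Variable A : finType.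

Definition tape_read (t : tape A) : symbol A := head None (tape_right t).

Definition tape_write (a : symbol A) (t : tape A) : tape A :=
  Tape (tape_left t) (a :: behead (tape_right t)).

Definition tape_move (d : direction) (t : tape A) : tape A :=
  match d with
  | Left => Tape (behead (tape_left t))
                 (head None (tape_left t) :: tape_right t)
  | Stay => t
  | Right => Tape (tape_read t :: tape_left t) (behead (tape_right t))
  end.

Definition tape_of_word (w : word) : tape A :=
  Tape [::] [seq Some (inl b) | b <- w].

Fixpoint bits_prefix (s : seq (symbol A)) : word :=
  if s is Some (inl b) :: s' then b :: bits_prefix s' else [::].

(* The longest binary word that starts at the scanned cell. *)
Definition word_of_tape (t : tape A) : word := bits_prefix (tape_right t).

End Tapes.

Section Runs.

Variable M : turing_machine.

Record config := Config {
  cfg_state : tm_state M;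
  cfg_tape : 'I_(tm_tapes M).+2 -> tape (tm_aux M) }.

(* The [i]-th input word is on the [i]-th tape, the other tapes are blank. *)
Definition initial (ws : seq word) : config :=
  Config (tm_start M) (fun i => tape_of_word (tm_aux M) (nth [::] ws i)).

Definition step (c : config) : option config :=
  if tm_delta (cfg_state c) [ffun i => tape_read (cfg_tape c i)]
    is Some (q, act)
  then Some (Config q (fun i => tape_move (act i).2
                                  (tape_write (act i).1 (cfg_tape c i))))
  else None.

Definition halted (c : config) : bool := ~~ isSome (step c).

(* The configuration after [t] steps; a halted machine stays as it is. *)
Definition run (t : nat) (ws : seq word) : config :=
  iter t (fun c => odflt c (step c)) (initial ws).

Definition accepting (c : config) : bool := tm_accept (cfg_state c).

Definition output (c : config) : word := word_of_tape (cfg_tape c ord0).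

End Runs.

(** * Polynomial time, NP and NP-completeness *)

Definition language := word -> Prop.

Definition polytime_function (f : word -> word) : Prop :=
  exists (M : turing_machine) (q : {poly nat}), forall x : word,
    let c := run M q.[size x]%R [:: x] in halted c /\ output c = f x.

Definition polytime_relation (R : word -> word -> Prop) : Prop :=
  exists (M : turing_machine) (q : {poly nat}), forall x u : word,
    let c := run M q.[size x + size u]%R [:: x; u] in
    halted c /\ (R x u <-> accepting c).

Definition in_NP (L : language) : Prop :=
  exists2 R : word -> word -> Prop, polytime_relation R &
    exists r : {poly nat}, forall x : word,
      L x <-> exists2 u : word, size u <= r.[size x]%R & R x u.

Definition polytime_reducible (L1 L2 : language) : Prop :=
  exists2 f : word -> word, polytime_function f &
    forall x : word, L1 x <-> L2 (f x).

Definition NP_hard (L : language) : Prop :=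
  forall L' : language, in_NP L' -> polytime_reducible L' L.

Definition NP_complete (L : language) : Prop := in_NP L /\ NP_hard L.

(** * The decision problem *)

(* Binary digits of [p > 0], least significant first. *)
Definition binary (p : nat) : word :=
  mkseq (fun i => odd (p %/ 2 ^ i)) (trunc_log 2 p).+1.

(* The number of vertices in unary, closed by a [false], then the adjacency
   matrix row by row, then [p] in binary. *)
Definition encode (n : nat) (e : rel 'I_n) (p : nat) : word :=
  nseq n true ++ false ::
    [seq e i j | i <- enum 'I_n, j <- enum 'I_n] ++ binary p.

Definition m_convex_cover_problem : language := fun w =>
  exists (n : nat) (e : rel 'I_n) (p : nat),
    [/\ symmetric e, irreflexive e, 3 <= p, w = encode e p &
        has_m_convex_cover e p].

(* Main.v *)
(* Let [u0] and [u1] be two nonadjacent vertices adjacent to every other vertex. If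
   an m-convex set contains two nonadjacent vertices, then it contains their common
   neighbours, hence [u0] and [u1], hence everything: the proper m-convex sets are
   the cliques. Covering such a graph by p of them amounts to colouring its
   complement, and Karp's graph with N + 1 colours encodes a CNF formula in N
   variables with clauses of any length. The formula of Cook and Levin is made of
   Horn clauses that propagate the symbols of a tableau, so that a satisfying
   assignment must contain the run on the certificate it selects; no clause
   excludes two symbols in a cell.

   For membership in NP, a set S is certified by a relation that contains
   connectedness in its complement, and is such that neighbours in S of related
   vertices are equal or adjacent; the number p, which may be exponentially large,
   is compared with indices below the number of vertices through the certified
   relations j < p / 2^i.

   Polynomial time is obtained from a language of bounded formulas, and of loops
   that output the truth values of such formulas, over variables that range below
   polynomials in the length of the input. Its programs run on machines where the
   position of a head on a blank tape serves as a counter. *)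

From HB Require Import structures.
From mathcomp Require Import all_boot all_order all_algebra.
From mathcomp Require Import zify.
From Stdlib Require Import FunctionalExtensionality.
Require Import Defs.

Set Implicit Arguments.
Unset Strict Implicit.
Unset Printing Implicit Defensive.

Import GRing.Theory.

(** * Machine fragments *)

(** In Karp's graph the N colour vertices exhaust N of the N + 1 colours. Of two opposite literals,
    one shares the colour of its variable and the other takes the spare one. A dummy variable,
    absent from all clauses, has a literal with the spare colour too; as no clause vertex is
    adjacent to it, every clause must take the colour of a variable, hence has a true literal. This
    is what allows clauses of any length.

    A cell of the tableau may hold several columns, but a certificate can be chosen whose whole run
    is among them, and then a nonaccepting end contradicts a final clause. Fixing the origin and
    moving the tapes lets a rule look at four columns only, whatever the number of tapes.

    Convexity speaks of all induced paths, of which there may be exponentially many. A path that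
    leaves S crosses a component of the complement, and it is induced only if it enters and leaves
    between nonadjacent neighbours of that component. A relation closed under the steps outside S
    suffices to exclude this, so reachability never has to be computed.

    Only upper bounds on running times are kept: they add up, and monotone polynomials absorb the
    slack. *)

Section Fragments.

Variables (A : finType) (K : nat).

Definition reads : Type := {ffun 'I_K.+2 -> symbol A}.
Definition actions : Type := 'I_K.+2 -> symbol A * direction.
Definition tapes : Type := 'I_K.+2 -> tape A.

(* A piece of control flow; it is left through one of two exits, [inr true] and
   [inr false], so that a fragment is both a command and a test. *)
Record fragment := Fragment {
  frag_state : finType;
  frag_start : frag_state;
  frag_delta : frag_state -> reads -> (frag_state + bool) * actions }.

Definition read_all (tp : tapes) : reads := [ffun i => tape_read (tp i)].

Definition act_all (a : actions) (tp : tapes) : tapes :=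
  fun i => tape_move (a i).2 (tape_write (a i).1 (tp i)).

Definition fstep (F : fragment) (c : (frag_state F + bool) * tapes) :=
  match c.1 with
  | inl s => let d := frag_delta s (read_all c.2) in (d.1, act_all d.2 c.2)
  | inr _ => c
  end.

Lemma fstep_inl F s tp : @fstep F (inl s, tp) =
  ((frag_delta s (read_all tp)).1, act_all (frag_delta s (read_all tp)).2 tp).
Proof. by []. Qed.

(** After its exit a fragment idles, so [n] bounds the running time from above and may be rounded up
    freely. *)
Definition runs (F : fragment) (tp : tapes) (n : nat) (b : bool) (tp' : tapes) :=
  iter n (@fstep F) (inl (frag_start F), tp) = (inr b, tp').

Lemma iter_fstep_exit F n b tp :
  iter n (@fstep F) (inr b, tp) = (inr b, tp).
Proof. by elim: n => //= n ->. Qed.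

Lemma runs_le F tp n m b tp' : n <= m -> runs F tp n b tp' -> runs F tp m b tp'.
Proof.
move=> /subnK <-; rewrite /runs iterD => ->; exact: iter_fstep_exit.
Qed.

(** A simulation of [F] on some states of [M], with the exit [b] redirected to [k b]. One notion
    serves every component of [ite] and [while]. *)
Definition embeds (F M : fragment) (h : frag_state F -> frag_state M)
    (k : bool -> frag_state M + bool) :=
  forall s r, frag_delta (h s) r =
    let d := frag_delta s r in
    (match d.1 with inl s' => inl (h s') | inr b => k b end, d.2).

(** [F] may exit early and idle up to step [n], whereas [M] would carry on from [k b]; hence a
    possibly smaller number [m] of steps. *)
Lemma embeds_runs F M h k : embeds h k -> forall n s tp b tp',
  iter n (@fstep F) (inl s, tp) = (inr b, tp') ->
  exists2 m, m <= n & iter m (@fstep M) (inl (h s), tp) = (k b, tp').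
Proof.
move=> hk; elim=> [//|n IHn] s tp b tp'.
rewrite iterSr fstep_inl; set d := frag_delta s _.
case E: d.1 => [s'|b'].
  move=> /IHn [m le_mn Hm]; exists m.+1 => //.
  by rewrite iterSr fstep_inl hk -/d /= E.
rewrite iter_fstep_exit => -[<- <-]; exists 1 => //.
by rewrite iterSr fstep_inl hk -/d /= E.
Qed.

Definition prim (t : reads -> bool) (a : reads -> actions) : fragment :=
  Fragment tt (fun _ r => (inr (t r), a r)).

Definition ite (F G H : fragment) : fragment :=
  @Fragment (frag_state F + (frag_state G + frag_state H))%type (inl (frag_start F))
    (fun s r => match s with
     | inl s => let d := frag_delta s r in
         (match d.1 with
          | inl s' => inl (inl s')
          | inr b => inl (inr (if b then inl (frag_start G) else inr (frag_start H)))
          end, d.2)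
     | inr (inl s) => let d := frag_delta s r in
         (match d.1 with inl s' => inl (inr (inl s')) | inr b => inr b end, d.2)
     | inr (inr s) => let d := frag_delta s r in
         (match d.1 with inl s' => inl (inr (inr s')) | inr b => inr b end, d.2)
     end).

Definition while (F G : fragment) : fragment :=
  @Fragment (frag_state F + frag_state G)%type (inl (frag_start F))
    (fun s r => match s with
     | inl s => let d := frag_delta s r in
         (match d.1 with
          | inl s' => inl (inl s')
          | inr b => if b then inl (inr (frag_start G)) else inr true
          end, d.2)
     | inr s => let d := frag_delta s r in
         (match d.1 with
          | inl s' => inl (inr s')
          | inr b => inl (inl (frag_start F))
          end, d.2)
     end).

Lemma prim_runs t a tp :
  runs (prim t a) tp 1 (t (read_all tp)) (act_all (a (read_all tp)) tp).
Proof. by []. Qed.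

Lemma runs_trans (M : fragment) n n' m c1 c2 c3 :
  iter n (@fstep M) c1 = c2 -> iter n' (@fstep M) c2 = c3 -> n' + n <= m ->
  (exists b, c3.1 = inr b) -> iter m (@fstep M) c1 = c3.
Proof.
move=> E1 E2 /subnK <- [b Eb]; rewrite !iterD E1 E2.
by case: c3 Eb {E2} => [_ tp] /= ->; rewrite iter_fstep_exit.
Qed.

Lemma ite_runs F G H tp n b tp1 m b' tp2 :
  runs F tp n b tp1 -> runs (if b then G else H) tp1 m b' tp2 ->
  runs (ite F G H) tp (m + n) b' tp2.
Proof.
move=> /(@embeds_runs F (ite F G H) inl
  (fun b => inl (inr (if b then inl (frag_start G) else inr (frag_start H)))))
  [] // n1 le1 R1.
case: b R1 => R1.
  move=> /(@embeds_runs G (ite F G H) (inr \o inl) inr) [] // n2 le2 R2.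
  by apply: (runs_trans R1 R2); [exact: leq_add | exists b'].
move=> /(@embeds_runs H (ite F G H) (inr \o inr) inr) [] // n2 le2 R2.
by apply: (runs_trans R1 R2); [exact: leq_add | exists b'].
Qed.

Lemma while_runs_false F G tp n tp1 :
  runs F tp n false tp1 -> runs (while F G) tp n true tp1.
Proof.
move=> /(@embeds_runs F (while F G) inl
  (fun b => if b then inl (inr (frag_start G)) else inr true)) [] // n1 le1 R1.
exact: (runs_le le1 R1).
Qed.

Lemma while_runs_true F G tp n tp1 m b tp2 l tp3 :
  runs F tp n true tp1 -> runs G tp1 m b tp2 ->
  runs (while F G) tp2 l true tp3 ->
  runs (while F G) tp (l + m + n) true tp3.
Proof.
move=> /(@embeds_runs F (while F G) inl
  (fun b => if b then inl (inr (frag_start G)) else inr true)) [] // n1 le1 R1.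
move=> /(@embeds_runs G (while F G) inr (fun=> inl (inl (frag_start F)))) [] //
  n2 le2 R2 R3.
have {}R1: iter (n2 + n1) (@fstep (while F G)) (inl (inl (frag_start F)), tp)
    = (inl (inl (frag_start F)), tp2) by rewrite iterD R1.
apply: (runs_trans R1 R3); last by exists true.
by rewrite -addnA leq_add2l leq_add.
Qed.

Definition machine (F : fragment) : turing_machine :=
  @TuringMachine K (frag_state F + bool)%type A (inl (frag_start F))
    (fun s => s == inr true)
    (fun s r => match s with
     | inl s => Some (frag_delta s r)
     | inr _ => None
     end).

Definition input_tapes (ws : seq word) : tapes :=
  fun i => tape_of_word A (nth [::] ws i).

Lemma machine_run F ws n b tp :
  runs F (input_tapes ws) n b tp ->
  run (machine F) n ws = @Config (machine F) (inr b) tp.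
Proof.
move=> R.
have E c : odflt c (@step (machine F) c) =
    let c' := @fstep F (cfg_state c, cfg_tape c) in @Config (machine F) c'.1 c'.2.
  case: c => [s t] /=; rewrite /step /fstep /=.
  case: s => [s|b'] //=.
  by case: (frag_delta s _).
have run_iter : forall m, run (machine F) m ws =
    let c' := iter m (@fstep F) (inl (frag_start F), input_tapes ws) in
    @Config (machine F) c'.1 c'.2.
  elim=> [//|m IHm]; rewrite /run iterS -/(run (machine F) m ws) IHm E /=.
  by case: (iter m _ _).
by rewrite run_iter R.
Qed.

End Fragments.

(** * Heads as counters *)

Section Positions.

Variable A : finType.

(* Cells to the left of position 0 are not constrained: no fragment goes there. *)
Definition at_pos (f : nat -> symbol A) (p : nat) (t : tape A) :=
  (forall j, nth None (tape_right t) j = f (p + j)) /\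
  (forall j, j < p -> nth None (tape_left t) j = f (p - j.+1)).

Lemma at_pos_read f p t : at_pos f p t -> tape_read t = f p.
Proof. by case=> /(_ 0); rewrite addn0 /tape_read -nth0. Qed.

Lemma at_pos_write f p t :
  at_pos f p t -> at_pos f p (tape_write (tape_read t) t).
Proof.
case=> Hr Hl; split=> //= -[|j] /=; first by rewrite -Hr /tape_read -nth0.
by rewrite nth_behead Hr.
Qed.

Lemma at_pos_right f p t : at_pos f p t -> at_pos f p.+1 (tape_move Right t).
Proof.
move=> H; have Hread := at_pos_read H; case: H => Hr Hl; split=> /= [j|[|j]] /=.
- by rewrite nth_behead Hr addnS.
- by rewrite subn1.
- by rewrite ltnS subSS => /Hl.
Qed.

Lemma at_pos_left f p t : 0 < p -> at_pos f p t -> at_pos f p.-1 (tape_move Left t).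
Proof.
case: p => // p _ [Hr Hl]; split=> /= [[|j]|j lt_jp] /=.
- by rewrite -nth0 Hl // subSS subn0 addn0.
- by rewrite Hr addSnnS.
- by rewrite nth_behead Hl ?ltnS // subSS.
Qed.

End Positions.

(* Tape 0 collects the output when [em] is set; as the output is produced from
   right to left, it is the word that starts just after the head. *)
Section Programs.

Variables (K : nat) (em : bool) (cont : nat -> nat -> symbol unit).

Notation fragment := (fragment unit K).
Notation tapes := (tapes unit K).

Definition tape_inv (i p : nat) (o : word) (t : tape unit) : Prop :=
  if em && (i == 0) then bits_prefix (behead (tape_right t)) = o
  else at_pos (cont i) p t.

Definition store := nat -> nat.

Definition represents (s : store) (o : word) (tp : tapes) : Prop :=
  forall j : 'I_K.+2, tape_inv j (s j) o (tp j).

(** A Hoare triple with a time bound and an exit; it mentions head positions and the output word,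
    and abstracts from the tapes that represent them. *)
Definition computes (F : fragment) (s : store) (o : word) (n : nat) (b : bool)
    (s' : store) (o' : word) :=
  forall tp, represents s o tp ->
  exists2 tp', represents s' o' tp' & runs F tp n b tp'.

Definition usable (i : nat) : bool := (i < K.+2) && ~~ (em && (i == 0)).

Lemma computes_le F s o n m b s' o' :
  n <= m -> computes F s o n b s' o' -> computes F s o m b s' o'.
Proof.
by move=> le_nm H tp /H [tp' R /(runs_le le_nm) H']; exists tp'.
Qed.

Lemma computes_ite F G H s o n b s1 o1 m b' s2 o2 l :
  computes F s o n b s1 o1 ->
  computes (if b then G else H) s1 o1 m b' s2 o2 -> m + n <= l ->
  computes (ite F G H) s o l b' s2 o2.
Proof.
move=> HF HG le_l tp /HF [tp1 /HG [tp2 R2 H2] H1].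
by exists tp2 => //; apply: runs_le le_l _; exact: ite_runs H1 H2.
Qed.

Lemma computes_while_false F G s o n s1 o1 m :
  computes F s o n false s1 o1 -> n <= m -> computes (while F G) s o m true s1 o1.
Proof.
move=> HF le_m tp /HF [tp1 R1 H1]; exists tp1 => //.
by apply: runs_le le_m _; apply: while_runs_false.
Qed.

Lemma computes_while_true F G s o n s1 o1 m b s2 o2 l s3 o3 k :
  computes F s o n true s1 o1 -> computes G s1 o1 m b s2 o2 ->
  computes (while F G) s2 o2 l true s3 o3 -> l + m + n <= k ->
  computes (while F G) s o k true s3 o3.
Proof.
move=> HF HG HW le_k tp /HF [tp1 /HG [tp2 /HW [tp3 R3 H3] H2] H1].
by exists tp3 => //; apply: runs_le le_k _; apply: while_runs_true H1 H2 H3.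
Qed.

Definition stay_all (r : reads unit K) : actions unit K := fun j => (r j, Stay).

Definition test (P : reads unit K -> bool) : fragment := prim P stay_all.

Definition const (b : bool) : fragment := test (fun=> b).

Definition seqf (F G : fragment) : fragment := ite F G G.

Lemma represents_read s o tp i : represents s o tp -> usable i ->
  read_all tp (inord i) = cont i (s i).
Proof.
move=> R /andP[lt_i live]; rewrite ffunE.
have := R (inord i); rewrite /tape_inv inordK // (negbTE live).
exact: at_pos_read.
Qed.

Lemma represents_stay s o tp : represents s o tp ->
  represents s o (act_all (stay_all (read_all tp)) tp).
Proof.
move=> R j; have := R j; rewrite /tape_inv /act_all /= ffunE.
case: ifP => // _; exact: at_pos_write.
Qed.

Lemma computes_test P b s o :
  (forall tp, represents s o tp -> P (read_all tp) = b) ->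
  computes (test P) s o 1 b s o.
Proof.
move=> Hb tp R; exists (act_all (stay_all (read_all tp)) tp).
  exact: represents_stay.
by rewrite -(Hb tp R); apply: prim_runs.
Qed.

Lemma computes_const b s o : computes (const b) s o 1 b s o.
Proof. exact: computes_test. Qed.

Definition shift (L R : seq nat) : fragment :=
  prim (fun=> true) (fun r j => (r j,
    if val j \in R then Right else if val j \in L then Left else Stay)).

Definition shifted (L R : seq nat) (v : nat) (s : store) : store :=
  fun j => if j \in R then s j + v else if j \in L then s j - v else s j.

Lemma computes_shift L R s o :
  all usable (L ++ R) -> all (fun i => 0 < s i) L ->
  computes (shift L R) s o 1 true (shifted L R 1 s) o.
Proof.
rewrite all_cat => /andP[/allP uL /allP uR] /allP pos tp Rep.
exists (act_all (fun j => (read_all tp j,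
  if val j \in R then Right else if val j \in L then Left else Stay)) tp).
  move=> j; have := Rep j; rewrite /tape_inv /act_all /shifted /= ffunE.
  case: ifP => [Ej|_].
    have nR : (val j \in R) = false.
      by apply: contraTF Ej => /uR /andP[].
    have nL : (val j \in L) = false.
      by apply: contraTF Ej => /uL /andP[].
    by rewrite nR nL.
  move=> /at_pos_write H; case: ifP => _; first by rewrite addn1; apply: at_pos_right.
  case: ifP => // /pos lt0; rewrite subn1; exact: at_pos_left.
exact: prim_runs.
Qed.

Definition emit_bit (b : bool) : fragment :=
  prim (fun=> true) (fun r j =>
    if val j == 0 then (Some (inl b), Left) else (r j, Stay)).

Lemma computes_emit_bit b s o : em -> computes (emit_bit b) s o 1 true s (b :: o).
Proof.
move=> Eem tp R.
exists (act_all (fun j => if val j == 0 then (Some (inl b), Left)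
                          else (read_all tp j, Stay)) tp); last exact: prim_runs.
move=> j; have := R j; rewrite /tape_inv /act_all Eem /= ffunE.
by case: (j == 0 :> nat) => /= [<- //|]; exact: at_pos_write.
Qed.

(* The value of a counter is the position of its head; only cell 0 is marked. *)
Definition counter (i : nat) :=
  usable i /\ forall p, cont i p = if p == 0 then Some (inr tt) else None.

Definition nonzero (i : nat) : fragment :=
  test (fun r => r (inord i) == None).

Lemma computes_nonzero i s o : counter i ->
  computes (nonzero i) s o 1 (s i != 0) s o.
Proof.
move=> [ui ci]; apply: computes_test => tp R.
by rewrite (represents_read R ui) ci; case: (s i).
Qed.

(** A head position is read by driving the head back to 0, which destroys it. A value is therefore
    copied by pouring it into two counters and one of these back. The tapes in [L] are rewound by
    the same amount. *)
Definition transfer (i : nat) (L R : seq nat) : fragment :=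
  while (nonzero i) (shift (i :: L) R).

(** Each unit costs one test and one parallel shift, and the failing test one more step:
    [2 * s i + 1] in all. *)
Lemma computes_transfer i L R s o n : counter i -> all usable (L ++ R) ->
  i \notin R -> ~~ has (mem R) L -> all (fun j => s i <= s j) L -> 2 * s i < n ->
  computes (transfer i L R) s o n true (shifted (i :: L) R (s i) s) o.
Proof.
move=> ci uLR iR LR; move: {2}(s i) (erefl (s i)) => v.
elim: v s n => [|v IHv] s n Ev geL lt_n.
  have -> : shifted (i :: L) R (s i) s = s.
    by apply: functional_extensionality => j; rewrite Ev /shifted addn0 subn0 !if_same.
  apply: (@computes_while_false _ _ _ _ 1); last by lia.
  by have := @computes_nonzero i s o ci; rewrite Ev.
have E1 j : j \in i :: L -> shifted (i :: L) R 1 s j = s j - 1.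
  move=> jL; rewrite /shifted jL; case: ifP => // jR.
  move: jL; rewrite inE => /orP[/eqP Ej|jL]; first by rewrite -Ej jR in iR.
  by case/hasP: LR; exists j.
have Ei := E1 i (mem_head _ _).
apply: (@computes_while_true _ _ s o 1 s o 1 true (shifted (i :: L) R 1 s) o
   (n - 2)); last by lia.
- by have := @computes_nonzero i s o ci; rewrite Ev.
- apply: computes_shift; first by case: ci => ui _; rewrite /= ui.
  rewrite /= Ev /=; apply: sub_all geL => j; lia.
have -> : shifted (i :: L) R (s i) s =
    shifted (i :: L) R (shifted (i :: L) R 1 s i) (shifted (i :: L) R 1 s).
  apply: functional_extensionality => j; rewrite Ei Ev subn1 /= /shifted.
  by case: ifP => jR; [lia | case: ifP => jL; lia].
apply: IHv; rewrite Ei ?Ev //; [lia| |lia].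
apply/allP => j jL; move/allP: geL => /(_ j jL) H.
by rewrite E1 ?inE ?jL ?orbT //; lia.
Qed.

End Programs.

(** * A language of bounded formulas and word generators *)

Definition upd (s : store) (k v : nat) : store := fun j => if j == k then v else s j.

(* The argument of [Len] and [Bit] selects one of two words. *)
Inductive term :=
  | Var of nat | Cst of nat | Add of term & term | Mul of term & term | Len of bool.

(* [Ex t f] binds the variable whose number is the current length of the
   environment, and ranges over the naturals below [t]. *)
Inductive form :=
  | Lt of term & term | Eq of term & term | Bit of bool & term
  | Not of form | And of form & form | Ex of term & form.

Inductive gen :=
  | Nil | Out of form | Cat of gen & gen | If of form & gen | For of term & gen.

Section Semantics.

Variable wd : bool -> word.

Fixpoint evalT (r : seq nat) (t : term) : nat :=
  match t with
  | Var i => nth 0 r i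
  | Cst n => n
  | Add a b => evalT r a + evalT r b
  | Mul a b => evalT r a * evalT r b
  | Len w => size (wd w)
  end.

Fixpoint evalF (r : seq nat) (f : form) : bool :=
  match f with
  | Lt a b => evalT r a < evalT r b
  | Eq a b => evalT r a == evalT r b
  | Bit w t => nth false (wd w) (evalT r t)
  | Not f => ~~ evalF r f
  | And f g => evalF r f && evalF r g
  | Ex t f => has (fun v => evalF (rcons r v) f) (iota 0 (evalT r t))
  end.

Fixpoint evalG (r : seq nat) (g : gen) : word :=
  match g with
  | Nil => [::]
  | Out f => [:: evalF r f]
  | Cat g h => evalG r g ++ evalG r h
  | If f g => if evalF r f then evalG r g else [::]
  | For t g => flatten [seq evalG (rcons r v) g | v <- iota 0 (evalT r t)]
  end.

End Semantics.

(** A generous bound on the number of counters that the compiled code touches from the first free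
    one on; it determines the number of tapes. *)
Fixpoint needT (t : term) : nat :=
  match t with
  | Var _ | Len _ => 2
  | Cst _ => 1
  | Add a b => needT a + needT b + 2
  | Mul a b => needT a + needT b + 4
  end.

Fixpoint needF (f : form) : nat :=
  match f with
  | Lt a b | Eq a b => needT a + needT b + 2
  | Bit _ t => needT t + 2
  | Not f => needF f
  | And f g => needF f + needF g
  | Ex t f => needT t + (needF f).+1
  end.

Fixpoint needG (g : gen) : nat :=
  match g with
  | Nil => 0
  | Out f => needF f
  | Cat g h => needG g + needG h
  | If f g => needF f + needG g
  | For t g => needT t + (needG g).+1
  end.

(* [valT t B] bounds the value of [t], and [costT t B] the time to compute it,
   when the variables and the lengths of the words are at most [B]. *)
Fixpoint valT (t : term) (B : nat) : nat :=
  match t with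
  | Var _ | Len _ => B
  | Cst n => n
  | Add a b => valT a B + valT b B
  | Mul a b => valT a B * valT b B
  end.

Fixpoint costT (t : term) (B : nat) : nat :=
  match t with
  | Var _ | Len _ => 4 * B + 2
  | Cst n => n.+1
  | Add a b => costT a B + costT b B + (2 * valT b B + 1)
  | Mul a b => costT a B + costT b B + valT a B * (4 * valT b B + 4) + 1
               + (2 * valT b B + 1)
  end.

Fixpoint costF (f : form) (B : nat) : nat :=
  match f with
  | Lt a b | Eq a b =>
      costT a B + costT b B + 4 * (valT a B + valT b B) + 5
  | Bit _ t => costT t B + 4 * valT t B + 4
  | Not f => costF f B + 1
  | And f g => costF f B + costF g B + 1
  | Ex t f => costT t B + valT t B * (costF f (B + valT t B) + 4)
              + 2 * valT t B + 10
  end.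

Fixpoint costG (g : gen) (B : nat) : nat :=
  match g with
  | Nil => 1
  | Out f => costF f B + 1
  | Cat g h => costG g B + costG h B
  | If f g => costF f B + costG g B + 1
  | For t g => costT t B + valT t B * (costG g (B + valT t B) + 2) + 1
  end.

Section Compiler.

Variables (K : nat) (em : bool) (wt : bool -> nat).

Notation fragment := (fragment unit K).

(** Tapes 0 to 2 are reserved for the output and the words, so variable [i] is in counter [3 + i].
    The value is left in counter [k], and the counters above it return to 0. For [Mul], [k.+1]
    counts rounds, [k.+2] keeps the second factor and [k.+3] serves to copy it. For [Len], the head
    walks to the end of the word, and [k.+1] records the way back. *)
Fixpoint compT (d k : nat) (t : term) : fragment :=
  match t with
  | Var i => if i < d then
      seqf (transfer K (3 + i) [::] [:: k; k.+1]) (transfer K k.+1 [::] [:: 3 + i])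
      else const K true
  | Cst n => iter n (seqf (shift K [::] [:: k])) (const K true)
  | Add a b => seqf (compT d k a) (seqf (compT d k.+1 b) (transfer K k.+1 [::] [:: k]))
  | Mul a b => seqf (compT d k.+1 a) (seqf (compT d k.+2 b)
      (seqf (while (nonzero K k.+1) (seqf (shift K [:: k.+1] [::])
         (seqf (transfer K k.+2 [::] [:: k; k.+3]) (transfer K k.+3 [::] [:: k.+2]))))
         (transfer K k.+2 [::] [::])))
  | Len w => seqf (while (test (fun r => r (inord (wt w)) != None))
                         (shift K [::] [:: wt w; k; k.+1]))
                  (transfer K k.+1 [:: wt w] [::])
  end.

Definition compare (k : nat) (P : bool -> bool -> bool) : fragment :=
  test (fun r => P (r (inord k) == None) (r (inord k.+1) == None)).

Definition clear2 (k : nat) (b : bool) : fragment :=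
  seqf (transfer K k [::] [::]) (seqf (transfer K k.+1 [::] [::]) (const K b)).

(** Both values decrease together until one vanishes; which of them is still nonzero decides the
    order. A counter reads blank exactly when it is nonzero. *)
Definition compare_terms (d : nat) (P : bool -> bool -> bool) (a b : term) : fragment :=
  let k := 3 + d in
  seqf (compT d k a) (seqf (compT d k.+1 b)
    (seqf (while (compare k andb) (shift K [:: k; k.+1] [::]))
       (ite (compare k P) (clear2 k true) (clear2 k false)))).

Fixpoint compF (d : nat) (f : form) : fragment :=
  let k := 3 + d in
  match f with
  | Lt a b => compare_terms d (fun _ y => y) a b
  | Eq a b => compare_terms d (fun x y => ~~ x && ~~ y) a b
  (* The head of the word is sent to the cell in question, with the distance saved in [k.+1] for the
     return. Past the end of the word it reads a blank, in accordance with the default [false] of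
     [nth]. *)
  | Bit w t => seqf (compT d k t) (seqf (transfer K k [::] [:: k.+1; wt w])
      (ite (test (fun r => r (inord (wt w)) == Some (inl true)))
           (seqf (transfer K k.+1 [:: wt w] [::]) (const K true))
           (seqf (transfer K k.+1 [:: wt w] [::]) (const K false))))
  | Not f => ite (compF d f) (const K false) (const K true)
  | And f g => ite (compF d f) (compF d g) (const K false)
  | Ex t f => seqf (compT d k t)
      (seqf
        (* The loop is left with a nonzero counter exactly when a witness has
           been found. *)
        (while (ite (nonzero K k)
                  (seqf (shift K [:: k] [::])
                     (ite (compF d.+1 f) (seqf (shift K [::] [:: k]) (const K false))
                                         (const K true)))
                  (const K false))
               (const K true))
        (ite (nonzero K k) (seqf (transfer K k [::] [::]) (const K true))
                           (const K false)))
  end.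

(** Output grows to the left: this is why [Cat] runs [h] before [g] and why loops count
    downwards. *)
Fixpoint compG (d : nat) (g : gen) : fragment :=
  let k := 3 + d in
  match g with
  | Nil => const K true
  | Out f => ite (compF d f) (emit_bit K true) (emit_bit K false)
  | Cat g h => seqf (compG d h) (compG d g)
  | If f g => ite (compF d f) (compG d g) (const K true)
  | For t g => seqf (compT d k t)
      (while (nonzero K k) (seqf (shift K [:: k] [::]) (compG d.+1 g)))
  end.

Variables (cont : nat -> nat -> symbol unit) (wd : bool -> word).

Hypothesis wt_usable : forall w, usable K em (wt w).
Hypothesis wt_lt3 : forall w, wt w < 3.
Hypothesis wt_cont : forall w p,
  cont (wt w) p = nth None [seq Some (inl b) | b <- wd w] p.
Hypothesis counters : forall i p, 3 <= i ->
  cont i p = if p == 0 then Some (inr tt) else None.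

Notation computes := (computes em cont).

Lemma counter_ge3 k : 3 <= k < K.+2 -> counter K em cont k.
Proof.
case/andP=> ge3 lt_k; split; last by move=> p; rewrite counters.
by rewrite /usable lt_k; case: k ge3 {lt_k} => [|k] //; rewrite andbF.
Qed.

Lemma usable_ge3 k : 3 <= k < K.+2 -> usable K em k.
Proof. by case/counter_ge3. Qed.

Lemma seqf_computes F G s o n b s1 o1 m b' s2 o2 l :
  computes F s o n b s1 o1 -> computes G s1 o1 m b' s2 o2 -> m + n <= l ->
  computes (@seqf K F G) s o l b' s2 o2.
Proof. by move=> HF HG; apply: computes_ite HF _; case: b. Qed.

(** The invariant of the loop is given by the families [S] and [O], indexed by the current value of
    the counter. *)
Lemma countdown_computes k G (S : nat -> store) (O : nat -> word) c v n :
  counter K em cont k -> (forall m, m <= v -> S m k = m) ->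
  (forall m, m < v -> computes G (S m.+1) (O m.+1) c true (S m) (O m)) ->
  v * c.+1 < n ->
  computes (@while _ K (nonzero K k) G) (S v) (O v) n true (S 0) (O 0).
Proof.
move=> ck; elim: v n => [|v IHv] n Sk HG lt_n.
  apply: (@computes_while_false _ _ _ _ _ _ _ 1); last by lia.
  by have := @computes_nonzero K em cont k (S 0) (O 0) ck; rewrite Sk.
apply: (@computes_while_true _ _ _ _ _ _ _ 1 (S v.+1) (O v.+1) c true (S v) (O v)
  (v * c.+1).+1).
- by have := @computes_nonzero K em cont k (S v.+1) (O v.+1) ck; rewrite Sk.
- exact: HG.
- apply: IHv => // m lt_m; [apply: Sk | apply: HG]; lia.
- lia.
Qed.

(** The state between two evaluations: the environment is in place, the counters from [k] on are 0,
    and the heads of the words are back at the first cell. *)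
Definition ready (r : seq nat) (k : nat) (s : store) : Prop :=
  [/\ 3 + size r <= k, forall i, i < size r -> s (3 + i) = nth 0 r i,
      forall j, k <= j -> s j = 0 & forall w, s (wt w) = 0].

Lemma ready_upd r k s v : ready r k s -> ready r k.+1 (upd s k v).
Proof.
move=> [le_k Hr H0 Hw]; split=> [|i lt_i|j lt_j|w]; rewrite /upd.
- exact: leqW.
- by rewrite ifN ?Hr //; apply/eqP; lia.
- by rewrite ifN ?H0 //; [lia | apply/eqP; lia].
- by rewrite ifN ?Hw //; apply/eqP; have := wt_lt3 w; lia.
Qed.

Ltac eq_cases :=
  rewrite ?eqxx /=;
  repeat match goal with
    |- context [@eq_op _ ?x ?y] => case: (eqVneq x y) => ? end;
  rewrite /=; try lia.

Ltac store_eq j :=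
  apply: functional_extensionality => j; rewrite /shifted /upd ?inE /=;
  repeat match goal with
    |- context [@eq_op _ j ?x] => case: (eqVneq j x) => [->|?] end;
  eq_cases.

Lemma compT_computes t r k s o B :
  ready r k s -> k + needT t <= K.+2 ->
  (forall i, nth 0 r i <= B) -> (forall w, size (wd w) <= B) ->
  computes (compT (size r) k t) s o (costT t B) true (upd s k (evalT wd r t)) o
  /\ evalT wd r t <= valT t B.
Proof.
elim: t k s => [i|n|a IHa b IHb|a IHa b IHb|w] k s Hs Hk HB Hw /=;
  case: (Hs) => le_k Hr H0 Hh /=; rewrite /= in Hk;
  have s0 := H0 k (leqnn k); have s1 := H0 k.+1 (leqnSn k).
- split=> //; case: ltnP => lt_i; last first.
    rewrite nth_default // (_ : upd s k 0 = s).
      by apply: (@computes_le _ _ _ _ _ _ 1); [lia | apply: computes_const].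
    by store_eq j.
  have Hi : s (3 + i) = nth 0 r i by exact: Hr.
  have leB := HB i.
  apply: (@seqf_computes _ _ _ _ (2 * B + 1) _ _ _ (2 * B + 1)).
  + apply: computes_transfer => /=; rewrite ?usable_ge3 ?Hi ?inE //; try lia.
    by apply: counter_ge3; lia.
  + set s' := shifted _ _ _ _.
    have E : s' k.+1 = nth 0 r i by rewrite /s' /shifted !inE eqxx orbT s1 Hi.
    have -> : upd s k (nth 0 r i) = shifted [:: k.+1] [:: 3 + i] (s' k.+1) s'.
      by rewrite E /s'; store_eq j.
    apply: computes_transfer => /=; rewrite ?usable_ge3 ?E ?inE //; try lia.
    by apply: counter_ge3; lia.
  + lia.
- split=> //; rewrite -[n in upd _ _ n]addn0 -s0.
  elim: n s {Hs Hr Hh H0 s0 s1} => [|n IHn] s /=.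
    rewrite add0n (_ : upd s k (s k) = s); first exact: computes_const.
    by store_eq j.
  apply: (@seqf_computes _ _ _ _ 1 _ _ _ n.+1); last by lia.
    by apply: computes_shift => //=; rewrite usable_ge3 //; lia.
  set s' := shifted _ _ _ _.
  have -> : upd s k (n.+1 + s k) = upd s' k (n + s' k).
    by rewrite /s'; store_eq j.
  exact: IHn.
- have [Ca Va] := IHa k s Hs ltac:(lia) HB Hw.
  have [Cb Vb] := IHb k.+1 _ (ready_upd (evalT wd r a) Hs) ltac:(lia) HB Hw.
  split; last exact: leq_add.
  apply: (seqf_computes Ca (m := costT b B + (2 * valT b B + 1))); last by lia.
  apply: (seqf_computes Cb (m := 2 * valT b B + 1)); last by lia.
  set s' := upd _ _ _.
  have E : s' k.+1 = evalT wd r b by rewrite /s' /upd eqxx.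
  have -> : upd s k (evalT wd r a + evalT wd r b) =
      shifted [:: k.+1] [:: k] (s' k.+1) s' by rewrite E /s'; store_eq j.
  apply: computes_transfer => /=; rewrite ?usable_ge3 ?E ?inE //; try lia.
  by apply: counter_ge3; lia.
- have Hs1 : ready r k.+1 s.
    by split=> // [|j lt_j]; [lia | apply: H0; lia].
  have [Ca Va] := IHa k.+1 s Hs1 ltac:(lia) HB Hw.
  have [Cb Vb] := IHb k.+2 _ (ready_upd (evalT wd r a) Hs1) ltac:(lia) HB Hw.
  set va := evalT wd r a in Ca Va Cb *; set vb := evalT wd r b in Cb Vb *.
  have s2 : s k.+2 = 0 by apply: H0; lia.
  have s3 : s k.+3 = 0 by apply: H0; lia.
  split; last exact: leq_mul.
  pose c := valT a B * (4 * valT b B + 4) + 1 + (2 * valT b B + 1).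
  apply: (seqf_computes Ca (m := costT b B + c)); last by rewrite /c; lia.
  apply: (seqf_computes Cb (m := c)); last by lia.
  (* The store when [m] rounds remain: [va - m] copies of [vb] have been added up in [k]. *)
  pose S m := upd (upd (upd s k ((va - m) * vb)) k.+1 m) k.+2 vb.
  have lt_c : va * (4 * vb + 4) <= valT a B * (4 * valT b B + 4).
    by apply: leq_mul => //; lia.
  apply: (@seqf_computes _ _ _ _ (va * (4 * vb + 4) + 1) true (S 0) o
    (2 * valT b B + 1)); last by rewrite /c; lia.
    have -> : upd (upd s k.+1 va) k.+2 vb = S va by rewrite /S subnn; store_eq j.
    apply: (@countdown_computes k.+1 _ S (fun=> o) (4 * vb + 3)).
    + by apply: counter_ge3; lia.
    + by move=> m _; rewrite /S /upd eqxx; case: eqVneq; lia.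
    + move=> m lt_m; set s' := S m.+1.
      apply: (@seqf_computes _ _ _ _ 1 _ _ _ (4 * vb + 2)); last by lia.
        apply: computes_shift => //=; first by rewrite usable_ge3 //; lia.
        by rewrite /s' /S /upd eqxx; case: eqVneq; lia.
      set s4 := shifted _ _ _ _.
      have E4 : s4 k.+2 = vb.
        by rewrite /s4 /s' /S /shifted /upd /= !inE eqxx; case: eqVneq; lia.
      have E5 : s4 k.+3 = 0.
        rewrite /s4 /s' /S; by rewrite /shifted /upd /= !inE; eq_cases.
      apply: (@seqf_computes _ _ _ _ (2 * vb + 1) true
        (shifted [:: k.+2] [:: k; k.+3] (s4 k.+2) s4) o (2 * vb + 1)); last by lia.
        apply: computes_transfer => /=; rewrite ?usable_ge3 ?E4 ?inE //; try lia.
        by apply: counter_ge3; lia.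
      set s6 := shifted _ _ _ _.
      have E6 : s6 k.+3 = vb.
        by rewrite /s6 /shifted E4 E5 !inE eqxx orbT.
      have -> : S m = shifted [:: k.+3] [:: k.+2] (s6 k.+3) s6.
        rewrite E6 /s6 E4 /s4 /s' /S.
        have -> : (va - m) * vb = (va - m.+1) * vb + vb by nia.
        store_eq j.
      apply: computes_transfer => /=; rewrite ?usable_ge3 ?E6 ?inE //; try lia.
      by apply: counter_ge3; lia.
    + by lia.
  have E0 : S 0 k.+2 = vb by rewrite /S /upd eqxx.
  have -> : upd s k (va * vb) = shifted [:: k.+2] [::] (S 0 k.+2) (S 0).
    by rewrite E0 /S subn0; store_eq j.
  apply: computes_transfer => /=; rewrite ?usable_ge3 ?E0 ?inE //; try lia.
  by apply: counter_ge3; lia.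
- split=> //.
  have HwB := Hw w; have w0 := Hh w; have w3 := wt_lt3 w.
  pose S m := upd (upd (upd s k m) k.+1 m) (wt w) m.
  set v := size (wd w) in HwB *.
  apply: (@seqf_computes _ _ _ _ (2 * v + 1) true (S v) o (2 * v + 1)); last by lia.
    (* The head advances from cell 0, so the induction is on the number of cells still ahead of
       it. *)
    have -> : s = S (v - v) by rewrite subnn /S; store_eq j.
    suff loop m : m <= v -> computes (while
        (test (fun r0 : reads unit K => r0 (inord (wt w)) != None))
        (shift K [::] [:: wt w; k; k.+1])) (S (v - m)) o (2 * m + 1) true (S v) o.
      exact: loop.
    elim: m => [|m IHm] le_m.
      rewrite subn0.
      apply: (@computes_while_false _ _ _ _ _ _ _ 1) => //.
      apply: computes_test => tp R.
      rewrite (represents_read R (wt_usable w)) wt_cont nth_default //.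
      by rewrite size_map /S /upd eqxx.
    set s' := S (v - m.+1).
    apply: (@computes_while_true _ _ _ _ _ _ _ 1 s' o 1 true (S (v - m)) o
      (2 * m + 1)); last by lia.
    + apply: computes_test => tp R.
      rewrite (represents_read R (wt_usable w)) wt_cont /s' /S /upd eqxx.
      by rewrite (nth_map false) //; lia.
    + have -> : S (v - m) = shifted [::] [:: wt w; k; k.+1] 1 s'.
        by rewrite /s' /S; store_eq j.
      by apply: computes_shift => //=; rewrite wt_usable !usable_ge3 //; lia.
    + exact: IHm (ltnW le_m).
  have E : S v k.+1 = v by rewrite /S /upd eqxx; case: eqVneq; lia.
  have -> : upd s k v = shifted [:: k.+1; wt w] [::] (S v k.+1) (S v).
    by rewrite E /S; store_eq j.
  apply: computes_transfer => /=; rewrite ?wt_usable ?E ?inE //; try lia.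
    by apply: counter_ge3; lia.
  by rewrite /S /upd eqxx leqnn.
Qed.

Lemma ready_rcons r s v : ready r (3 + size r) s ->
  ready (rcons r v) (3 + size (rcons r v)) (upd s (3 + size r) v).
Proof.
move=> Hs; have [] := ready_upd v Hs => _ _ H0 Hw.
split=> //; rewrite size_rcons // => i lt_i; rewrite nth_rcons /upd eqn_add2l.
case: (ltngtP i (size r)) lt_i => //= lt_i lt_i'; last by lia.
by case: Hs => _ ->.
Qed.

Lemma clear2_computes k b s o l : 3 <= k -> k.+1 < K.+2 ->
  2 * (s k + s k.+1) + 3 <= l ->
  computes (clear2 k b) s o l b (upd (upd s k 0) k.+1 0) o.
Proof.
move=> ge3 lt_k le_l; set s' := shifted [:: k] [::] (s k) s.
have E : s' k.+1 = s k.+1 by rewrite /s' /shifted !inE; case: eqVneq => //; lia.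
apply: (@seqf_computes _ _ _ _ (2 * s k + 1) true s' o (2 * s k.+1 + 2)); last by lia.
  apply: computes_transfer => //; last by lia.
  by apply: counter_ge3; lia.
have -> : upd (upd s k 0) k.+1 0 = shifted [:: k.+1] [::] (s' k.+1) s'.
  by rewrite E /s'; store_eq j.
apply: (@seqf_computes _ _ _ _ (2 * s k.+1 + 1)); [|exact: computes_const|lia].
apply: computes_transfer; rewrite ?E //; last by lia.
by apply: counter_ge3; lia.
Qed.

Lemma compare_computes k P s o : 3 <= k -> k.+1 < K.+2 ->
  computes (compare k P) s o 1 (P (s k != 0) (s k.+1 != 0)) s o.
Proof.
move=> ge3 lt_k; apply: computes_test => tp R.
rewrite !(represents_read R) ?usable_ge3 ?counters //; try lia.
by case: (s k) => [|?]; case: (s k.+1).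
Qed.

Lemma compare_terms_computes P a b r s o B :
  ready r (3 + size r) s -> 3 + size r + (needT a + needT b + 2) <= K.+2 ->
  (forall i, nth 0 r i <= B) -> (forall w, size (wd w) <= B) ->
  let va := evalT wd r a in let vb := evalT wd r b in
  computes (compare_terms (size r) P a b) s o
    (costT a B + costT b B + 4 * (valT a B + valT b B) + 5)
    (P (vb < va) (va < vb)) s o.
Proof.
move=> Hs Hk HB Hw va vb; rewrite /compare_terms; set k := 3 + size r in Hs Hk *.
have [Ca Va] := @compT_computes a r k s o B Hs ltac:(lia) HB Hw.
have [Cb Vb] := @compT_computes b r k.+1 _ o B (ready_upd va Hs) ltac:(lia) HB Hw.
rewrite -/va in Ca Va Cb; rewrite -/vb in Cb Vb.
have k3 : 3 <= k by rewrite leq_addr.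
have lt_k : k.+1 < K.+2 by lia.
apply: (seqf_computes Ca (m := costT b B + (4 * (valT a B + valT b B) + 5))); last by lia.
apply: (seqf_computes Cb (m := 4 * (valT a B + valT b B) + 5)); last by lia.
(* The store after [m] joint decrements; the loop stops at the minimum [q] of the two values. *)
pose S m := upd (upd s k (va - m)) k.+1 (vb - m).
have Sk m : S m k = va - m by rewrite /S /upd eqxx; case: eqVneq; lia.
have Sk1 m : S m k.+1 = vb - m by rewrite /S /upd eqxx.
pose q := minn va vb.
apply: (@seqf_computes _ _ _ _ (2 * q + 1) true (S q) o
  (2 * (valT a B + valT b B) + 4)); last by rewrite /q; lia.
  have -> : upd (upd s k va) k.+1 vb = S (q - q) by rewrite subnn /S !subn0.
  suff loop m : m <= q -> computes (while (compare k andb) (shift K [:: k; k.+1] [::]))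
      (S (q - m)) o (2 * m + 1) true (S q) o by exact: loop.
  elim: m => [|m IHm] le_m.
    rewrite subn0; apply: (@computes_while_false _ _ _ _ _ _ _ 1) => //.
    have := @compare_computes k andb (S q) o k3 lt_k.
    by rewrite Sk Sk1 (_ : _ && _ = false) //; apply/negbTE; rewrite /q; lia.
  apply: (@computes_while_true _ _ _ _ _ _ _ 1 (S (q - m.+1)) o 1 true
    (S (q - m)) o (2 * m + 1)); last by lia.
  - have := @compare_computes k andb (S (q - m.+1)) o k3 lt_k.
    by rewrite Sk Sk1 (_ : _ && _ = true) //; rewrite /q in le_m *; lia.
  - have -> : S (q - m) = shifted [:: k; k.+1] [::] 1 (S (q - m.+1)).
      by rewrite /S; store_eq j.
    apply: computes_shift; first by rewrite /= !usable_ge3 //; lia.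
    by rewrite /= Sk Sk1 /q; rewrite /q in le_m; lia.
  - exact: IHm (ltnW le_m).
apply: (computes_ite (@compare_computes k P (S q) o k3 lt_k)
  (m := 2 * (valT a B + valT b B) + 3)); last by lia.
rewrite Sk Sk1 (_ : (va - q != 0) = (vb < va)); last by rewrite /q; lia.
rewrite (_ : (vb - q != 0) = (va < vb)); last by rewrite /q; lia.
case: Hs => _ _ H0 _; have s0 := H0 k (leqnn k); have s1 := H0 k.+1 (leqnSn k).
have -> : s = upd (upd (S q) k 0) k.+1 0 by rewrite /S; store_eq j.
by case: (P _ _); apply: clear2_computes => //; rewrite Sk Sk1; lia.
Qed.

Lemma compF_computes f r s o B :
  ready r (3 + size r) s -> 3 + size r + needF f <= K.+2 ->
  (forall i, nth 0 r i <= B) -> (forall w, size (wd w) <= B) ->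
  computes (compF (size r) f) s o (costF f B) (evalF wd r f) s o.
Proof.
elim: f r s o B => [a b|a b|w t|f IHf|f IHf g IHg|t f IHf] r s o B Hs Hk HB Hw;
  rewrite /= in Hk *.
- exact: (@compare_terms_computes (fun _ y => y)).
- have := @compare_terms_computes (fun x y => ~~ x && ~~ y) a b r s o B Hs Hk HB Hw.
  by rewrite /= -!leqNgt andbC -eqn_leq eq_sym.
- set k := 3 + size r in Hs Hk *.
  have [C V] := @compT_computes t r k s o B Hs ltac:(lia) HB Hw.
  set v := evalT wd r t in C V *.
  have k3 : 3 <= k by rewrite leq_addr.
  case: (Hs) => _ _ H0 /(_ w) Hh; have w3 := wt_lt3 w.
  have s0 := H0 k (leqnn k); have s1 := H0 k.+1 (leqnSn k).
  apply: (seqf_computes C (m := 4 * valT t B + 4)); last by lia.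
  pose s2 := shifted [:: k] [:: k.+1; wt w] v (upd s k v).
  have E1 : upd s k v k = v by rewrite /upd eqxx.
  have E2 : s2 (wt w) = v.
    by rewrite /s2 /shifted !inE eqxx orbT /upd; case: eqVneq; lia.
  have E3 : s2 k.+1 = v.
    by rewrite /s2 /shifted !inE eqxx /upd /=; case: eqVneq; lia.
  apply: (@seqf_computes _ _ _ _ (2 * v + 1) true s2 o (2 * v + 3)); last by lia.
    have -> : s2 = shifted [:: k] [:: k.+1; wt w] (upd s k v k) (upd s k v).
      by rewrite E1.
    apply: computes_transfer; rewrite ?E1 ?inE //=; try lia.
      by apply: counter_ge3; lia.
    by rewrite usable_ge3 ?wt_usable //; lia.
  apply: (@computes_ite _ _ _ _ _ _ _ _ 1 (nth false (wd w) v) s2 o (2 * v + 2));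
    last by lia.
    apply: computes_test => tp R; rewrite (represents_read R (wt_usable w)) wt_cont E2.
    case: (ltnP v (size (wd w))) => lt_v; first by rewrite (nth_map false).
    by rewrite !nth_default ?size_map.
  have Hc b : computes (seqf (transfer K k.+1 [:: wt w] [::]) (const K b)) s2 o
      (2 * v + 2) b s o.
    apply: (@seqf_computes _ _ _ _ (2 * v + 1) true s o 1); last by lia.
      have -> : s = shifted [:: k.+1; wt w] [::] (s2 k.+1) s2.
        by rewrite E3 /s2; store_eq j.
      apply: computes_transfer; rewrite ?E3 //=; rewrite ?E2 ?wt_usable ?leqnn //; try lia.
      by apply: counter_ge3; lia.
    exact: computes_const.
  by case: nth; apply: Hc.
- apply: (computes_ite (IHf _ _ _ _ Hs Hk HB Hw) (m := 1)); last by lia.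
  by case: evalF; apply: computes_const.
- apply: (computes_ite (IHf _ _ o B Hs ltac:(lia) HB Hw) (m := costF g B + 1)); last by lia.
  case: evalF => /=; last first.
    by apply: (@computes_le _ _ _ _ _ _ 1); [lia | apply: computes_const].
  by apply: (computes_le _ (IHg _ _ o B Hs ltac:(lia) HB Hw)); lia.
- set k := 3 + size r in Hs Hk *.
  have [C V] := @compT_computes t r k s o B Hs ltac:(lia) HB Hw.
  (* The bound variable may exceed [B], so the body is charged at the larger bound [B']. *)
  set v := evalT wd r t in C V *; set B' := B + valT t B; set c := costF f B'.
  have k3 : 3 <= k by rewrite leq_addr.
  have ck : counter K em cont k by apply: counter_ge3; lia.
  have uk : usable K em k by case: ck.
  case: (Hs) => _ _ /(_ k (leqnn k)) s0 _.
  have Uk m : upd s k m k = m by rewrite /upd eqxx.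
  have nzk m : computes (nonzero K k) (upd s k m) o 1 (m != 0) (upd s k m) o.
    by have := @computes_nonzero K em cont k (upd s k m) o ck; rewrite Uk.
  have incr m : shifted [::] [:: k] 1 (upd s k m) = upd s k m.+1 by store_eq j.
  have decr m : shifted [:: k] [::] 1 (upd s k m.+1) = upd s k m by store_eq j.
  have lt_c : v * (c + 4) <= valT t B * (c + 4) by rewrite leq_mul2r V orbT.
  apply: (seqf_computes C (m := v * (c + 4) + 2 + (2 * valT t B + 3))); last by lia.
  set body := ite (nonzero K k) _ _.
  (* A search may stop early, so the rule for countdowns does not apply. Here [m'] is the counter at
     the exit: the successor of the witness found, or 0. *)
  have loop m : m <= v -> exists2 m', m' <= m &
      (m' != 0) = has (fun v => evalF wd (rcons r v) f) (iota 0 m) /\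
      computes (while body (const K true)) (upd s k m) o (m * (c + 4) + 2) true
        (upd s k m') o.
    elim: m => [|m IHm] le_m.
      exists 0 => //; split=> //; apply: (@computes_while_false _ _ _ _ _ _ _ 2) => //.
      apply: (computes_ite (nzk 0) (m := 1)) => //; exact: computes_const.
    have Hf : computes (compF (size r).+1 f) (upd s k m) o c
        (evalF wd (rcons r m) f) (upd s k m) o.
      have -> : (size r).+1 = size (rcons r m) by rewrite size_rcons.
      apply: IHf; [exact: ready_rcons | rewrite size_rcons; lia | | ].
        move=> i; rewrite nth_rcons; case: ifP => _.
          by apply: leq_trans (HB i) _; rewrite leq_addr.
        by case: ifP => _ //; rewrite /B'; lia.
      by move=> w; apply: leq_trans (Hw w) _; rewrite leq_addr.
    have Hdec : computes (shift K [:: k] [::]) (upd s k m.+1) o 1 true (upd s k m) o.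
      by rewrite -(decr m); apply: computes_shift; rewrite /= ?uk ?Uk.
    have -> : iota 0 m.+1 = iota 0 m ++ [:: m] by rewrite -addn1 iotaD.
    rewrite has_cat /= orbF; case Ef: (evalF wd (rcons r m) f) Hf => Hf.
      exists m.+1 => //; split; first by rewrite orbT.
      apply: (@computes_while_false _ _ _ _ _ _ _ (c + 4)); last by lia.
      apply: (computes_ite (nzk m.+1) (m := c + 3)); last by lia.
      apply: (seqf_computes Hdec (m := c + 2)); last by lia.
      apply: (computes_ite Hf (m := 2)); last by lia.
      apply: (@seqf_computes _ _ _ _ 1 true (upd s k m.+1) o 1) => //.
        by rewrite -(incr m); apply: computes_shift; rewrite /= ?uk.
      exact: computes_const.
    have [m' le_m' [Em' Cm']] := IHm (ltnW le_m).
    exists m'; first exact: leqW.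
    split; first by rewrite orbF.
    apply: (@computes_while_true _ _ _ _ _ _ _ (c + 3) (upd s k m) o 1 true _ o
      _ _ _ _ _ (@computes_const _ _ _ _ _ _) Cm'); last by lia.
    apply: (computes_ite (nzk m.+1) (m := c + 2)); last by lia.
    apply: (seqf_computes Hdec (m := c + 1)); last by lia.
    by apply: (computes_ite Hf (m := 1)); [exact: computes_const | lia].
  have [m' le_m' [<- Cm']] := loop v (leqnn v).
  apply: (seqf_computes Cm' (m := 2 * valT t B + 3)); last by lia.
  apply: (computes_ite (nzk m') (m := 2 * valT t B + 2)); last by lia.
  case: eqVneq => Em' /=.
    rewrite Em' (_ : upd s k 0 = s); last by store_eq j.
    by apply: (@computes_le _ _ _ _ _ _ 1); [lia | apply: computes_const].
  apply: (@seqf_computes _ _ _ _ (2 * m' + 1) true s o 1); [|exact: computes_const|lia].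
  have {2}-> : s = shifted [:: k] [::] (upd s k m' k) (upd s k m').
    by rewrite Uk; store_eq j.
  by apply: computes_transfer; rewrite ?Uk //; lia.
Qed.

Lemma compG_computes g r s o B : em ->
  ready r (3 + size r) s -> 3 + size r + needG g <= K.+2 ->
  (forall i, nth 0 r i <= B) -> (forall w, size (wd w) <= B) ->
  computes (compG (size r) g) s o (costG g B) true s (evalG wd r g ++ o).
Proof.
move=> Eem; elim: g r s o B => [|f|g IHg h IHh|f g IHg|t g IHg] r s o B Hs Hk HB Hw;
  rewrite /= in Hk *.
- exact: computes_const.
- apply: (computes_ite (@compF_computes f r s o B Hs Hk HB Hw) (m := 1)); last by lia.
  by case: evalF; apply: computes_emit_bit.
- rewrite -catA; apply: (seqf_computes (IHh _ _ o B Hs ltac:(lia) HB Hw)).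
    exact: (IHg _ _ _ B Hs ltac:(lia) HB Hw).
  by [].
- apply: (computes_ite (@compF_computes f r s o B Hs ltac:(lia) HB Hw)
    (m := costG g B + 1)); last by lia.
  case: evalF => /=; last first.
    by apply: (@computes_le _ _ _ _ _ _ 1); [lia | apply: computes_const].
  by apply: (computes_le _ (IHg _ _ o B Hs ltac:(lia) HB Hw)); lia.
- set k := 3 + size r in Hs Hk *.
  have [C V] := @compT_computes t r k s o B Hs ltac:(lia) HB Hw.
  set v := evalT wd r t in C V *; set B' := B + valT t B; set c := costG g B'.
  have k3 : 3 <= k by rewrite leq_addr.
  have ck : counter K em cont k by apply: counter_ge3; lia.
  have uk : usable K em k by case: ck.
  case: (Hs) => _ _ /(_ k (leqnn k)) s0 _.
  have Uk m : upd s k m k = m by rewrite /upd eqxx.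
  have decr m : shifted [:: k] [::] 1 (upd s k m.+1) = upd s k m by store_eq j.
  have lt_c : v * (c + 2) <= valT t B * (c + 2) by rewrite leq_mul2r V orbT.
  apply: (seqf_computes C (m := v * (c + 2) + 1)); last by lia.
  (* The output once the iterations from [m] up to [v - 1] have been carried out, in descending
     order. *)
  pose O m := flatten [seq evalG wd (rcons r i) g | i <- iota m (v - m)] ++ o.
  have {2}-> : s = upd s k 0 by store_eq j.
  have -> : flatten [seq evalG wd (rcons r i) g | i <- iota 0 v] ++ o = O 0.
    by rewrite /O subn0.
  have -> : o = O v by rewrite /O subnn.
  apply: (@countdown_computes k _ (upd s k) O (c + 1)) => //; last by lia.
  move=> m lt_m.
  apply: (@seqf_computes _ _ _ _ 1 true (upd s k m) (O m.+1) c); last by lia.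
    by rewrite -(decr m); apply: computes_shift; rewrite /= ?uk ?Uk.
  have -> : O m = evalG wd (rcons r m) g ++ O m.+1.
    by rewrite /O -(subnSK lt_m) /= catA.
  have -> : (size r).+1 = size (rcons r m) by rewrite size_rcons.
  apply: IHg; [exact: ready_rcons | rewrite size_rcons; lia | | ].
    move=> i; rewrite nth_rcons; case: ifP => _.
      by apply: leq_trans (HB i) _; rewrite leq_addr.
    by case: ifP => _ //; rewrite /B'; lia.
  by move=> w; apply: leq_trans (Hw w) _; rewrite leq_addr.
Qed.

End Compiler.

(** * Polynomial time *)

Definition is_polynomial (f : nat -> nat) : Prop :=
  exists q : {poly nat}, forall n, f n = q.[n]%R.

Lemma is_polynomial_cst c : is_polynomial (fun=> c).
Proof. by exists (c%:P)%R => n; rewrite hornerC. Qed.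

Lemma is_polynomial_id : is_polynomial id.
Proof. by exists 'X%R => n; rewrite hornerX. Qed.

Lemma is_polynomialD f g :
  is_polynomial f -> is_polynomial g -> is_polynomial (fun n => f n + g n).
Proof. by move=> [p Hp] [q Hq]; exists (p + q)%R => n; rewrite hornerD Hp Hq. Qed.

Lemma is_polynomialM f g :
  is_polynomial f -> is_polynomial g -> is_polynomial (fun n => f n * g n).
Proof. by move=> [p Hp] [q Hq]; exists (p * q)%R => n; rewrite hornerM Hp Hq. Qed.

Lemma is_polynomial_comp f g :
  is_polynomial f -> is_polynomial g -> is_polynomial (fun n => f (g n)).
Proof. by move=> [p Hp] [q Hq]; exists (p \Po q)%R => n; rewrite horner_comp Hp Hq. Qed.

Ltac poly :=
  by do ?[ exact: is_polynomial_cst | exact: is_polynomial_id | assumption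
         | apply: is_polynomialD | apply: is_polynomialM ].

Lemma is_polynomial_valT t : is_polynomial (valT t).
Proof. by elim: t => [i|n|a IHa b IHb|a IHa b IHb|w] /=; poly. Qed.

Lemma is_polynomial_costT t : is_polynomial (costT t).
Proof.
elim: t => [i|n|a IHa b IHb|a IHa b IHb|w] /=; try poly.
all: have Va := is_polynomial_valT a; have Vb := is_polynomial_valT b; poly.
Qed.

Lemma is_polynomial_costF f : is_polynomial (costF f).
Proof.
elim: f => [a b|a b|w t|f IHf|f IHf g IHg|t f IHf] /=; try poly.
- have Va := is_polynomial_valT a; have Vb := is_polynomial_valT b.
  have Ca := is_polynomial_costT a; have Cb := is_polynomial_costT b; poly.
- have Va := is_polynomial_valT a; have Vb := is_polynomial_valT b.
  have Ca := is_polynomial_costT a; have Cb := is_polynomial_costT b; poly.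
- have V := is_polynomial_valT t; have C := is_polynomial_costT t; poly.
- have V := is_polynomial_valT t; have C := is_polynomial_costT t.
  have Cf : is_polynomial (fun B => costF f (B + valT t B)).
    by apply: is_polynomial_comp IHf _; poly.
  poly.
Qed.

Lemma is_polynomial_costG g : is_polynomial (costG g).
Proof.
elim: g => [|f|g IHg h IHh|f g IHg|t g IHg] /=; try poly.
- have C := is_polynomial_costF f; poly.
- have C := is_polynomial_costF f; poly.
- have V := is_polynomial_valT t; have C := is_polynomial_costT t.
  have Cg : is_polynomial (fun B => costG g (B + valT t B)).
    by apply: is_polynomial_comp IHg _; poly.
  poly.
Qed.

Lemma at_pos_write_any (A : finType) (f : nat -> symbol A) p t a :
  at_pos f p t -> at_pos (fun q => if q == p then a else f q) p (tape_write a t).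
Proof.
case=> Hr Hl; split=> [[|j]|j lt_j] /=; first by rewrite addn0 eqxx.
  by rewrite nth_behead Hr ifN //; apply/eqP; lia.
by rewrite Hl // ifN //; apply/eqP; lia.
Qed.

Lemma at_pos_of_word (A : finType) (w : word) :
  at_pos (fun p => nth None [seq Some (inl b) | b <- w] p) 0 (tape_of_word A w).
Proof. by []. Qed.

Definition counter_tape (p : nat) : symbol unit := if p == 0 then Some (inr tt) else None.

Definition word_tape (w : word) (p : nat) : symbol unit :=
  nth None [seq Some (inl b) | b <- w] p.

(** Counter tapes are blank at the start; the symbol put in cell 0 is what makes the value 0
    recognisable. *)
Definition mark_counters (K : nat) : fragment unit K :=
  prim (fun=> true)
    (fun r j => (if 3 <= val j then Some (inr tt) else r j, Stay)).

Definition marked (K : nat) (ws : seq word) : tapes unit K :=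
  fun j => if 3 <= val j then tape_write (Some (inr tt)) (tape_of_word _ (nth [::] ws j))
           else tape_write (tape_read (tape_of_word _ (nth [::] ws j)))
                  (tape_of_word _ (nth [::] ws j)).

Lemma mark_counters_runs K ws :
  runs (mark_counters K) (@input_tapes unit K ws) 1 true (@marked K ws).
Proof.
rewrite /runs /=; congr pair; apply: functional_extensionality => j.
by rewrite /act_all /marked /= ffunE; case: ifP.
Qed.

Lemma marked_counter K ws (j : 'I_K.+2) : size ws <= 3 -> 3 <= j ->
  at_pos counter_tape 0 (@marked K ws j).
Proof.
move=> le3 ge3; rewrite /marked ge3 nth_default; last exact: leq_trans ge3.
by split=> // -[|i] //=; rewrite nth_nil.
Qed.

Lemma marked_word K ws (j : 'I_K.+2) : j < 3 ->
  at_pos (word_tape (nth [::] ws j)) 0 (@marked K ws j).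
Proof.
by move=> lt3; rewrite /marked leqNgt lt3 /=; apply: at_pos_write; apply: at_pos_of_word.
Qed.

Lemma seqf_runs K (F G : fragment unit K) tp n b tp1 m b' tp2 :
  runs F tp n b tp1 -> runs G tp1 m b' tp2 -> runs (seqf F G) tp (m + n) b' tp2.
Proof. by move=> HF HG; apply: ite_runs HF _; case: b. Qed.

Definition pair_of_words (x u : word) (w : bool) : word := if w then u else x.

(** A test has no output, so the two inputs are used in place: [nat_of_bool] sends each word to its
    tape. The additional step marks the counters. *)
Theorem form_polytime (f : form) :
  polytime_relation (fun x u => evalF (pair_of_words x u) [::] f).
Proof.
pose K := (needF f).+3.
have [q Hq] : is_polynomial (fun n => costF f n + 1).
  by have C := is_polynomial_costF f; poly.
exists (machine (seqf (mark_counters K) (compF K nat_of_bool 0 f))), q => x u.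
rewrite -Hq; set n := size x + size u; set ws := [:: x; u].
pose cont i := if i < 3 then word_tape (nth [::] ws i) else counter_tape.
have [tp _ R] : exists2 tp, represents false cont (fun=> 0) [::] tp &
    runs (compF K nat_of_bool 0 f) (@marked K ws) (costF f n)
      (evalF (pair_of_words x u) [::] f) tp.
  have C : computes false cont (compF K nat_of_bool 0 f) (fun=> 0) [::] (costF f n)
      (evalF (pair_of_words x u) [::] f) (fun=> 0) [::].
    apply: (@compF_computes K false nat_of_bool cont (pair_of_words x u) _ _ _ _ f [::]) => //.
    - by case.
    - by case.
    - by case=> p.
    - by move=> i p ge3; rewrite /cont ltnNge ge3.
    - by rewrite /K /=; lia.
    - by move=> i; rewrite nth_nil.
    - by case; rewrite /n /=; lia.
  apply: C => j; rewrite /tape_inv /= /cont; case: ltnP => Hj; last exact: marked_counter.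
  exact: marked_word.
have {}R := seqf_runs (mark_counters_runs K ws) R.
rewrite (machine_run R) /halted /accepting /=; split=> //.
by case: evalF.
Qed.

(** * Machines that write words *)

Section Generators.

Variables (K : nat) (x : word).
Hypothesis K3 : 3 < K.+2.

(** Tape 0 must receive the output, so the input is copied to tape 1, and counter 3 records its
    length for the rewinding. The head of tape 0 ends up just past the input; the output will
    overwrite the input from there leftwards, with a blank at its right end. *)
Definition copy_input : fragment unit K :=
  while (test (fun r => r ord0 != None))
    (prim (fun=> true) (fun r j =>
       if val j == 0 then (r j, Right) else
       if val j == 1 then (r ord0, Right) else
       if val j == 3 then (r j, Right) else (r j, Stay))).

Definition copied (i : nat) (tp : tapes unit K) : Prop :=
  [/\ at_pos (word_tape x) i (tp ord0),
      at_pos (word_tape (take i x)) i (tp (inord 1)) &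
      forall j : 'I_K.+2, 1 < j ->
        at_pos (if j == 2 :> nat then fun=> None else counter_tape)
               (if j == 3 :> nat then i else 0) (tp j)].

Lemma word_tape_take i q : i < size x ->
  (if q == i then word_tape x i else word_tape (take i x) q) = word_tape (take i.+1 x) q.
Proof.
move=> lt_i; rewrite /word_tape !map_take; set w := [seq _ | _ <- x].
case: (ltngtP q i) => [lt_q|gt_q|->]; last by rewrite nth_take.
  by rewrite !nth_take // ltnW.
by rewrite !nth_default // size_take size_map; case: ifP; lia.
Qed.

Lemma copied_stay i tp : copied i tp ->
  copied i (act_all (@stay_all K (read_all tp)) tp).
Proof.
case=> C0 C1 Cj; split=> [||j lt_j]; rewrite /act_all /= ffunE; apply: at_pos_write => //.
exact: Cj.
Qed.

Lemma copied_step i tp : i < size x -> copied i tp ->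
  copied i.+1 (act_all (fun j =>
       if val j == 0 then (read_all tp j, Right) else
       if val j == 1 then (read_all tp ord0, Right) else
       if val j == 3 then (read_all tp j, Right) else (read_all tp j, Stay)) tp).
Proof.
move=> lt_i [C0 C1 Cj]; split=> [||j lt_j]; rewrite /act_all /=.
- by rewrite ffunE; apply: at_pos_right; apply: at_pos_write.
- rewrite inordK //= ffunE (at_pos_read C0).
  have := at_pos_right (at_pos_write_any (word_tape x i) C1).
  by congr at_pos; apply: functional_extensionality => q; apply: word_tape_take.
- have := Cj j lt_j; rewrite ffunE.
  case: (nat_of_ord j) lt_j => [|[|[|[|k]]]] //= _; try exact: at_pos_write.
  by move=> /at_pos_write; apply: at_pos_right.
Qed.

Lemma copy_input_runs tp : copied 0 tp ->
  exists2 tp', copied (size x) tp' & runs copy_input tp (3 * size x + 1) true tp'.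
Proof.
suff H m : forall tp, m <= size x -> copied (size x - m) tp ->
    exists2 tp', copied (size x) tp' & runs copy_input tp (3 * m + 1) true tp'.
  by move=> C; apply: H => //; rewrite subnn.
elim: m => [|m IHm] {}tp le_m C.
  rewrite subn0 in C; exists (act_all (@stay_all K (read_all tp)) tp).
    exact: copied_stay.
  apply: while_runs_false.
  rewrite (_ : false = (read_all tp ord0 != None)); first exact: prim_runs.
  rewrite ffunE; case: C => /at_pos_read -> _ _.
  by rewrite /word_tape nth_default ?size_map.
set i := size x - m.+1 in C *; have lt_i : i < size x by rewrite /i; lia.
have C' := copied_step lt_i (copied_stay C).
have [|tp' C2 R2] := IHm _ (ltnW le_m) (eq_ind _ (fun k => copied k _) C' (size x - m) _).
  by rewrite /i; lia.
exists tp' => //; apply: runs_le (while_runs_true (n := 1) _ (prim_runs _ _ _) R2); first by lia.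
rewrite (_ : true = (read_all tp ord0 != None)); first exact: prim_runs.
rewrite ffunE; case: C => /at_pos_read -> _ _.
by rewrite /word_tape (nth_map false).
Qed.

End Generators.

Definition eject (K : nat) : fragment unit K :=
  prim (fun=> true) (fun r j => (r j, if val j == 0 then Right else Stay)).

Lemma bits_prefix_blank (A : finType) (s : seq (symbol A)) :
  nth None s 0 = None -> bits_prefix s = [::].
Proof. by case: s => [|[]]. Qed.

Theorem gen_polytime (g : gen) : polytime_function (fun x => evalG (fun=> x) [::] g).
Proof.
pose K := (needG g).+3.
(* Marking the counters and stepping onto the first output bit take one step each, copying
   [3 * n + 1] and rewinding [2 * n + 1]. *)
have [q Hq] : is_polynomial (fun n => costG g n + 5 * n + 4).
  by have C := is_polynomial_costG g; poly.
pose generate := compG K (fun=> 1) 0 g.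
pose F := seqf (mark_counters K) (seqf (copy_input K)
  (seqf (transfer K 3 [:: 1] [::]) (seqf generate (eject K)))).
exists (machine F), q => x; rewrite -Hq; set n := size x.
pose cont i := if i == 1 then word_tape x else if i == 2 then fun=> None else counter_tape.
have C0 : copied x 0 (@marked K [:: x]).
  split=> [||j lt_j].
  - exact: marked_word.
  - by have := @marked_word K [:: x] (inord 1); rewrite inordK //= => /(_ isT);
       rewrite take0.
  - case: (eqVneq (j : nat) 2) => [Ej|ne2] /=.
      have := @marked_word K [:: x] j; rewrite Ej /= => /(_ isT).
      congr at_pos; apply: functional_extensionality => p.
      by rewrite /word_tape nth_nil.
    by rewrite if_same; apply: marked_counter => //; lia.
have [tp1 [T0 T1 Tj] R1] := copy_input_runs (isT : 3 < K.+2) C0.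
pose s1 i := if i == 1 then n else if i == 3 then n else 0.
have Rep1 : represents true cont s1 [::] tp1.
  move=> j; rewrite /tape_inv; case: ifP => [j0|j0] /=.
    have -> : j = ord0 by apply/eqP.
    apply: bits_prefix_blank; rewrite nth_behead; case: T0 => -> _.
    by rewrite /word_tape nth_default // size_map; lia.
  rewrite /cont /s1; case: eqVneq => [j1|j1].
    have -> : j = inord 1 by apply: ord_inj; rewrite j1 inordK.
    by move: T1; rewrite take_size.
  have /Tj : 1 < j by move: (negbT j0) j1; case: (nat_of_ord j) => [|[]].
  by case: eqVneq => // ->.
have c3 : counter K true cont 3 by [].
have Rewind : computes true cont (transfer K 3 [:: 1] [::]) s1 [::] (2 * n + 1) true
    (fun=> 0) [::].
  have -> : (fun=> 0) = shifted [:: 3; 1] [::] (s1 3) s1.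
    apply: functional_extensionality => -[|[|[|[|j]]]] //; rewrite /shifted /s1 /=; lia.
  by apply: computes_transfer => //=; rewrite /s1 /=; lia.
have Gen : computes true cont generate (fun=> 0) [::] (costG g n) true (fun=> 0)
    (evalG (fun=> x) [::] g).
  rewrite -[evalG _ _ _]cats0.
  apply: (@compG_computes K true (fun=> 1) cont (fun=> x) _ _ _ _ g [::]) => //.
  - by move=> [|[|[|i]]].
  - by rewrite /K /=; lia.
  - by move=> i; rewrite nth_nil.
have [tp2 /Gen [tp3 Rep3 R3] R2] := Rewind _ Rep1.
have R4 := prim_runs (fun=> true)
  (fun r (j : 'I_K.+2) => (r j, if val j == 0 then Right else Stay)) tp3.
have R0 := seqf_runs (mark_counters_runs K [:: x])
  (seqf_runs R1 (seqf_runs R2 (seqf_runs R3 R4))).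
have R : runs F (@input_tapes unit K [:: x]) (costG g n + 5 * n + 4) true
    (act_all (fun j => (read_all tp3 j, if val j == 0 then Right else Stay)) tp3).
  by apply: runs_le R0; rewrite -/n; lia.
rewrite (machine_run R) /halted /output /=; split=> //.
by have := Rep3 ord0; rewrite /tape_inv /= => <-; rewrite /word_of_tape /act_all /=.
Qed.

(** * Satisfiability as a cover by convex sets *)

Section CliqueCovers.

Variables (T : finType) (e : rel T).
Hypotheses (e_sym : symmetric e) (e_irr : irreflexive e).

Lemma clique_m_convex (S : {set T}) :
  {in S &, forall x y, x != y -> e x y} -> m_convex e S.
Proof.
move=> clS x s [_ us ind] xS; case: s us ind => [|y [|z s]] us ind lS w.
- by rewrite inE => /eqP ->.
- by rewrite !inE => /orP[] /eqP ->.
(* The ends of a path with three or more vertices are not consecutive, yet they are adjacent in a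
   clique. *)
have := ind 0 (size s).+2 isT (ltnSn _).
rewrite nth0 (_ : nth x _ _ = last z s) /=; last by rewrite (last_nth x).
rewrite clS //; apply: contraNneq (andP us).1 => ->.
by rewrite inE mem_last orbT.
Qed.

Lemma m_convex_common_neighbour (S : {set T}) x y w :
  m_convex e S -> x \in S -> y \in S -> x != y -> ~~ e x y -> e x w -> e w y -> w \in S.
Proof.
move=> cS xS yS neq_xy nexy exw ewy.
apply: (cS x [:: w; y]) => //; last by rewrite !inE eqxx orbT.
split; rewrite /= ?exw ?ewy //.
  rewrite !inE negb_or neq_xy !andbT; apply/andP; split.
    by apply: contraTneq exw => ->; rewrite e_irr.
  by apply: contraTneq ewy => ->; rewrite e_irr.
by move=> [|i] [|[|[|j]]].
Qed.

Variable u : bool -> T.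
Hypotheses (u_neq : u false != u true) (u_nonadj : ~~ e (u false) (u true)).
Hypothesis u_univ : forall b x, x != u false -> x != u true -> e (u b) x.

Lemma proper_m_convex_clique (S : {set T}) :
  m_convex e S -> S != [set: T] -> {in S &, forall x y, x != y -> e x y}.
Proof.
move=> cS propS x y xS yS neq_xy; apply: contraNT propS => nexy.
have all_in : u false \in S -> u true \in S -> S == [set: T].
  move=> u0S u1S; apply/eqP/setP => w; rewrite inE.
  case: (eqVneq w (u false)) => [-> //|w0]; case: (eqVneq w (u true)) => [-> //|w1].
  by apply: (m_convex_common_neighbour cS u0S u1S); rewrite // ?u_univ // e_sym u_univ.
have other b z : z != u b -> ~~ e z (u b) -> z = u (~~ b).
  move=> zb nez; apply/eqP; apply: contraNT nez => znb.
  by rewrite e_sym u_univ //; case: b zb znb.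
have case_u b z : u b \in S -> z \in S -> z != u b -> ~~ e z (u b) -> S == [set: T].
  move=> ubS zS zb /(other _ _ zb) Ez; rewrite Ez in zS.
  by case: b ubS zS {zb Ez} => ubS zS; apply: all_in.
(* If [x] or [y] is a universal vertex, the other must be its only non-neighbour, so both universal
   vertices are in [S]. Otherwise both are common neighbours of [x] and [y]. *)
have [b /eqP Ex|x_u] := pickP (fun b => x == u b).
  by apply: (case_u b y); rewrite -?Ex // 1?eq_sym // e_sym.
have [b /eqP Ey|y_u] := pickP (fun b => y == u b).
  by apply: (case_u b x); rewrite -?Ey.
have uS b : u b \in S.
  apply: (m_convex_common_neighbour cS xS yS) => //; last by rewrite u_univ ?y_u.
  by rewrite e_sym u_univ ?x_u.
exact: all_in.
Qed.

Lemma m_convex_cover_colouring p :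
  has_m_convex_cover e p <->
  exists2 f : T -> nat, (forall x, f x < p) &
    forall x y, f x = f y -> x != y -> e x y.
Proof.
split=> [[V [cV pV covV]]|[f f_lt f_cl]].
  have inV x : exists i, x \in V i.
    by have : x \in \bigcup_(i < p) V i; [rewrite covV inE | case/bigcupP => i; exists i].
  exists (fun x => xchoose (inV x) : nat) => [x|x y Exy]; first exact: ltn_ord.
  have := xchooseP (inV y); rewrite -(ord_inj Exy) => yV.
  exact: (proper_m_convex_clique (cV _) (pV _) (xchooseP (inV x)) yV).
exists (fun i : 'I_p => [set x | f x == i]); split=> [i|i|].
- by apply: clique_m_convex => x y; rewrite !inE => /eqP <- /eqP /esym; apply: f_cl.
- apply/eqP => /setP all; case/negP: u_nonadj; apply: f_cl => //.
  by move: (all (u false)) (all (u true)); rewrite !inE => /eqP -> /eqP ->.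
- apply/setP => x; rewrite inE; apply/bigcupP.
  by exists (Ordinal (f_lt x)) => //; rewrite inE.
Qed.

End CliqueCovers.

(** * Karp's reduction from satisfiability to colouring the complement *)

Section Karp.

Variables (I C : eqType) (vars : seq I) (clauses : seq C) (occurs : C -> I -> bool -> bool).
Hypothesis vars_uniq : uniq vars.

(* [inl (i, None)] is the colour vertex of the variable [i], [inl (i, Some b)] the
   literal that is satisfied when [i] has the value [b]. *)
Definition vertex : Type := ((I * option bool) + (C + bool))%type.

(** The complement of Karp's graph, plus the two universal vertices. Literals of different variables
    are adjacent, so that all false ones can share the spare colour; clauses are adjacent to each
    other, so that they can share a witness. *)
Definition adjacent (x y : vertex) : bool :=
  match x, y with
  | inl (_, None), inl (_, None) => false
  | inl (i, None), inl (j, Some _) => i == j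
  | inl (i, Some _), inl (j, None) => i == j
  | inl (i, Some _), inl (j, Some _) => i != j
  | inl (_, None), inr (inl _) => true
  | inr (inl _), inl (_, None) => true
  | inl (i, Some b), inr (inl k) => occurs k i b
  | inr (inl k), inl (i, Some b) => occurs k i b
  | inr (inl k), inr (inl l) => k != l
  | inr (inr _), inr (inr _) => false
  | inr (inr _), _ => true
  | _, inr (inr _) => true
  end.

Definition is_vertex (x : vertex) : bool :=
  match x with
  | inl (i, _) => i \in vars
  | inr (inl k) => k \in clauses
  | inr (inr _) => true
  end.

Lemma adjacent_sym : symmetric adjacent.
Proof. by move=> [[i [b|]]|[k|b]] [[j [c|]]|[l|c]] //=; rewrite eq_sym. Qed.

Lemma adjacent_irr : irreflexive adjacent.
Proof. by move=> [[i [b|]]|[k|b]] //=; rewrite eqxx. Qed.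

Definition satisfies (a : I -> bool) : Prop :=
  forall k, k \in clauses -> exists2 i, i \in vars & occurs k i (a i).

Variable d : I.
Hypotheses (d_var : d \in vars) (d_free : forall k b, occurs k d b = false).

Lemma colouring_satisfiable :
  (exists2 f : vertex -> nat, (forall x, is_vertex x -> f x < (size vars).+1) &
     forall x y, is_vertex x -> is_vertex y -> f x = f y -> x != y -> adjacent x y)
  <-> exists a, satisfies a.
Proof.
split=> [[f f_lt f_adj]|[a sat_a]].
  pose v i : vertex := inl (i, None); pose lit i b : vertex := inl (i, Some b).
  have spare x y : is_vertex x -> is_vertex y ->
      (forall i, i \in vars -> f x <> f (v i)) ->
      (forall i, i \in vars -> f y <> f (v i)) -> f x = f y.
    move=> Vx Vy Nx Ny; apply/eqP; apply: contraT => neq_xy.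
    (* Two different colours, both foreign to the colour vertices, would bring the number of colours
       to at least N + 2. *)
    have us : uniq [:: f x, f y & [seq f (v i) | i <- vars]].
      rewrite /= inE negb_or neq_xy /= map_inj_in_uniq ?vars_uniq ?andbT.
        by apply/andP; split; apply/mapP => -[i iv E]; [case: (Nx i) | case: (Ny i)].
      move=> i j iv jv Eij; apply/eqP; apply: contraT => neq_ij.
      by apply: (f_adj (v i) (v j) iv jv Eij); apply: contraNneq neq_ij => -[->].
    have /(uniq_leq_size us) : {subset [:: f x, f y & [seq f (v i) | i <- vars]]
        <= iota 0 (size vars).+1}.
      move=> c; rewrite mem_iota !inE => /or3P[/eqP ->|/eqP ->|/mapP[i iv ->]];
      exact: f_lt.
    by rewrite /= size_map size_iota ltnn.
  have lit_cases i b : i \in vars -> f (lit i b) = f (v i) \/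
      forall j, j \in vars -> f (lit i b) <> f (v j).
    move=> iv; case: (eqVneq (f (lit i b)) (f (v i))) => [->|/eqP ne]; [by left|right].
    move=> j jv E; have := f_adj (lit i b) (v j) iv jv E (ltac:(by apply/eqP)).
    by rewrite /= => /eqP Eij; rewrite -Eij in E.
  have lit_ne i : i \in vars -> f (lit i true) <> f (lit i false).
    move=> iv E; have := f_adj (lit i true) (lit i false) iv iv E (ltac:(by apply/eqP; case)).
    by rewrite /= eqxx.
  pose a i := f (lit i true) == f (v i).
  have lit_a i : i \in vars -> f (lit i (a i)) = f (v i).
    move=> iv; rewrite /a; case: eqP => [//|ne1].
    case: (lit_cases i false iv) => // N0; case: (lit_cases i true iv) => // N1.
    by case: (lit_ne i iv); apply: spare.
  have lit_na i : i \in vars -> forall j, j \in vars -> f (lit i (~~ a i)) <> f (v j).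
    move=> iv; case: (lit_cases i (~~ a i) iv) => // E.
    have := lit_ne i iv; move: E (lit_a i iv).
    by case: (a i) => /= -> ->.
  exists a => k kc; pose c : vertex := inr (inl k).
  have [/hasP[i iv /eqP E]|/hasPn none] := boolP (has (fun i => f c == f (v i)) vars).
    exists i => //; rewrite -lit_a // in E.
    by have := f_adj c (lit i (a i)) kc iv E (ltac:(by apply/eqP)).
  (* A clause without the colour of a variable would share the spare colour with the false literal
     of [d], to which it is not adjacent. *)
  have : adjacent c (lit d (~~ a d)).
    apply: f_adj => //; apply: spare => //; last exact: lit_na.
    by move=> i /none /eqP.
  by rewrite /= d_free.
pose N := size vars.
(* False literals take the spare colour [N], and a clause the colour of the first variable that
   satisfies it. The universal vertices may join any two different classes; colours 0 and 1 exist
   because [d] is a variable. *)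
pose f (x : vertex) := match x with
  | inl (i, None) => index i vars
  | inl (i, Some b) => if b == a i then index i vars else N
  | inr (inl k) => find (fun i => occurs k i (a i)) vars
  | inr (inr b) => nat_of_bool b end.
have idx_lt i : i \in vars -> index i vars < N by rewrite index_mem.
have wit_lt k : k \in clauses -> find (fun i => occurs k i (a i)) vars < N.
  by move=> /sat_a[i iv oc]; rewrite -has_find; apply/hasP; exists i.
have N_gt0 : 0 < N by rewrite /N; case: vars d_var.
have idx_inj i j : i \in vars -> index i vars = index j vars -> i = j.
  by move=> iv Eij; rewrite -(nth_index d iv) Eij nth_index // -index_mem -Eij index_mem.
have wit_occ k i : k \in clauses -> i \in vars ->
    find (fun i => occurs k i (a i)) vars = index i vars -> occurs k i (a i).
  move=> kc iv E; rewrite -(nth_index d iv) -E.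
  apply: (nth_find d (a := fun i => occurs k i (a i))).
  by rewrite has_find wit_lt.
exists f => [[[i [b|]]|[k|b]]|] /=; rewrite -?/N.
- by move=> /idx_lt lt_i; case: ifP => _; lia.
- by move=> /idx_lt /leqW.
- by move=> /wit_lt /leqW.
- by case: b.
move=> [[i [b|]]|[k|b]] [[j [c|]]|[l|c]] //= Vx Vy.
- have := idx_lt i Vx; have := idx_lt j Vy.
  case: eqP => [->|/eqP nb]; case: eqP => [->|/eqP nc] lt_j lt_i E.
  + by rewrite (idx_inj _ _ Vx E) eqxx.
  + by rewrite E ltnn in lt_i.
  + by rewrite -E ltnn in lt_j.
  + apply: contraNneq => Eij; rewrite Eij in nb *.
    by case: b c (a j) nb nc => [] [] [].
- have := idx_lt i Vx; have := idx_lt j Vy.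
  by case: eqP => _; [move=> _ _ /(idx_inj _ _ Vx) ->; rewrite eqxx | lia].
- have := idx_lt i Vx; have := wit_lt l Vy.
  by case: eqP => [->|_]; [move=> _ _ /esym /(wit_occ _ _ Vy Vx) | lia].
- have := idx_lt i Vx; have := idx_lt j Vy.
  by case: eqP => _; [move=> _ _ /(idx_inj _ _ Vx) ->; rewrite eqxx | lia].
- by move=> /(idx_inj _ _ Vx) ->; rewrite eqxx.
- have := wit_lt k Vx; have := idx_lt j Vy.
  by case: eqP => [->|_]; [move=> _ _ /(wit_occ _ _ Vx Vy) | lia].
- by case: b c => [] [].
Qed.

Variable vs : seq vertex.
Hypotheses (vs_uniq : uniq vs) (vs_mem : forall x, (x \in vs) = is_vertex x).

Definition nth_vertex (i : nat) : vertex := nth (inr (inr false)) vs i.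

Lemma m_convex_cover_satisfiable :
  has_m_convex_cover (fun i j : 'I_(size vs) => adjacent (nth_vertex i) (nth_vertex j))
    (size vars).+1 <-> exists a, satisfies a.
Proof.
pose v0 : vertex := inr (inr false).
have lt_index x : is_vertex x -> index x vs < size vs by rewrite -vs_mem index_mem.
have nth_is i : i < size vs -> is_vertex (nth_vertex i).
  by move=> lt_i; rewrite -vs_mem mem_nth.
have nth_inj (i j : 'I_(size vs)) : nth_vertex i = nth_vertex j -> i = j.
  by move=> /eqP; rewrite nth_uniq // => /eqP /ord_inj.
pose u b : 'I_(size vs) := Ordinal (lt_index (inr (inr b)) isT).
have nth_u b : nth_vertex (u b) = inr (inr b) by rewrite /nth_vertex nth_index ?vs_mem.
rewrite (@m_convex_cover_colouring _ _ _ _ u).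
- rewrite -colouring_satisfiable; split=> -[f f_lt f_adj].
    exists (fun x => if insub (index x vs) is Some i then f i else 0) =>
      [x /lt_index lt_x|x y Vx Vy].
      by rewrite insubT.
    rewrite !insubT ?lt_index // => Vx' Vy' /f_adj.
    rewrite /nth_vertex /= !nth_index ?vs_mem // => H ne; apply: H.
    apply: contraNneq ne => /(congr1 val) /= E.
    by rewrite -(nth_index v0 (_ : x \in vs)) ?E ?nth_index ?vs_mem.
  exists (fun i : 'I_(size vs) => f (nth_vertex i)) => [i|i j E ne].
    by apply: f_lt; apply: nth_is.
  apply: f_adj => //; try exact: nth_is.
  by apply: contraNneq ne => /nth_inj ->.
- by move=> i j; apply: adjacent_sym.
- by move=> i; apply: adjacent_irr.
- by apply: contra_eq_neq (nth_u false) => ->; rewrite nth_u.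
- by rewrite !nth_u.
- move=> b x n0 n1; rewrite nth_u.
  have ne c : x != u c -> nth_vertex x != inr (inr c).
    by move=> nx; apply: contraNneq nx => E; apply/eqP/nth_inj; rewrite nth_u.
  by move: (ne _ n0) (ne _ n1); case: (nth_vertex x) => [[j [c|]]|[l|[]]].
Qed.

End Karp.

(** * Computations as satisfying assignments *)

Section Tableau.

Variables (M : turing_machine) (x : word) (T r : nat).
Hypothesis T_gt0 : 0 < T.
Hypothesis le_rT : r <= T.

Notation A := (tm_aux M).
Notation K := (tm_tapes M).

(* The head of every tape stays at the origin [T] of the array and the tapes
   move; a column of the tableau carries the state, the symbol of every tape,
   and a mark for the origin. *)
Definition column : finType :=
  (tm_state M * {ffun 'I_K.+2 -> symbol A} * bool)%type.

Definition cell (t : tape A) (c : nat) : symbol A :=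
  if T <= c then nth None (tape_right t) (c - T) else nth None (tape_left t) (T - c).-1.

Definition column_of (s : config M) (c : nat) : column :=
  (cfg_state s, [ffun i => cell (cfg_tape s i) c], c == T).

(** [g0], at the origin, determines the transition; [g1], [g2], [g3] stand at [c - 1], [c], [c + 1].
    When a head moves left, cell [c] of that tape receives the content of cell [c - 1], and the mark
    of the source column tells whether this content has just been overwritten. *)
Definition next_column (g0 g1 g2 g3 : column) : column :=
  if tm_delta g0.1.1 g0.1.2 is Some (q, act) then
    (q, [ffun i => let g := match (act i).2 with Left => g1 | Stay => g2 | Right => g3 end
                   in if g.2 then (act i).1 else g.1.2 i], g2.2)
  else g2.

Lemma cell_write a t c : cell (tape_write a t) c = if c == T then a else cell t c.
Proof.
rewrite /cell /=; case: ltngtP => // [lt_Tc|->]; last by rewrite subnn.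
by rewrite -(subnSK lt_Tc) /= nth_behead.
Qed.

Lemma cell_move d t c : 0 < c ->
  cell (tape_move d t) c =
  cell t (match d with Left => c.-1 | Stay => c | Right => c.+1 end).
Proof.
move=> c_gt0; case: d => //=; rewrite /cell /=.
- case: (ltngtP T c) => [lt_Tc|lt_cT|->].
  + rewrite (_ : T <= c.-1); last by lia.
    by rewrite (_ : c - T = (c.-1 - T).+1) //; lia.
  + rewrite (_ : T <= c.-1 = false); last by lia.
    by rewrite nth_behead; congr nth; lia.
  + rewrite subnn (_ : c <= c.-1 = false); last by lia.
    by rewrite /= (_ : (c - c.-1).-1 = 0) ?nth0 //; lia.
- case: (ltngtP T c.+1) => [lt_Tc|lt_cT|Ec].
  + by rewrite -ltnS lt_Tc nth_behead subSn.
  + rewrite (_ : T <= c = false); last by lia.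
    by rewrite (_ : (T - c).-1 = (T - c.+1).-1.+1) //; lia.
  + rewrite Ec ltnn subnn subSn // subnn /= /tape_read nth0 //.
Qed.

Lemma column_of_step s c : 0 < c ->
  column_of (odflt s (step s)) c =
  next_column (column_of s T) (column_of s c.-1) (column_of s c) (column_of s c.+1).
Proof.
move=> c_gt0; rewrite /next_column /step /=.
have -> : [ffun i => cell (cfg_tape s i) T] = [ffun i => tape_read (cfg_tape s i)].
  by apply/ffunP => i; rewrite !ffunE /cell leqnn subnn nth0.
case: tm_delta => [[q act]|] //=; congr (_, _, _); apply/ffunP => i.
rewrite !ffunE /= cell_move // cell_write.
by case: (act i).2; rewrite ffunE.
Qed.

Definition word_cell (w : word) (c : nat) : symbol A :=
  if T <= c then nth None [seq Some (inl b) | b <- w] (c - T) else None.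

Definition second : 'I_K.+2 := inord 1.

(* The columns that may occur in the first row, for some certificate. *)
Definition initial_column (g : column) (c : nat) : bool :=
  [&& g.1.1 == tm_start M, g.2 == (c == T), g.1.2 ord0 == word_cell x c,
      (g.1.2 second == None) ||
        ((g.1.2 second == Some (inl true)) || (g.1.2 second == Some (inl false)))
          && (T <= c < T + r) &
      [forall i : 'I_K.+2, (1 < i) ==> (g.1.2 i == None)]].

Definition blank (g : column) : bool := g.1.2 second == None.

Definition variable : eqType := (option column * (nat * nat))%type.

(* Rules, final clauses, and the two kinds of clauses about the first row: every
   cell has a symbol, and blanks of the certificate are followed by blanks. *)
Definition clause_tag : finType :=
  ((column * column * column * column) + (column + bool))%type.

Definition clause : eqType := (clause_tag * (nat * nat))%type.

(** A rule at [c] has negative literals for the origin and for the columns [c], [c + 1], [c + 2],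
    and updates [c + 1]. In the last case, [T + c + b] makes the literals negative at [T + c] and
    positive at [T + c + 1]. Only one blank column is initial at a given position, so that clause is
    an implication. *)
Definition occurs (k : clause) (i : variable) (b : bool) : bool :=
  match i with
  | (None, _) => false
  | (Some g, (t', c')) =>
    let: (tag, (t, c)) := k in
    match tag with
    | inl (g0, g1, g2, g3) =>
        if b then [&& t' == t.+1, c' == c.+1 & g == next_column g0 g1 g2 g3]
        else (t' == t) && [|| (c' == T) && (g == g0), (c' == c) && (g == g1),
                              (c' == c.+1) && (g == g2) | (c' == c.+2) && (g == g3)]
    | inr (inl g0) => [&& ~~ b, t' == T, c' == T & g == g0]
    | inr (inr false) => [&& b, t' == 0, c' == c & initial_column g c']
    | inr (inr true) => [&& blank g, t' == 0, c' == T + c + b & initial_column g c']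
    end
  end.

Definition var_range (o : option column) : nat * nat :=
  if o is Some _ then (T.+1, (2 * T).+1) else (1, 1).

(** The empty range of accepting columns restricts the final clauses to nonaccepting ones. A rule at
    [c] reads up to [c + 2 <= 2 * T], hence [(2 * T).-1] positions. *)
Definition clause_range (k : clause_tag) : nat * nat :=
  match k with
  | inl _ => (T, (2 * T).-1)
  | inr (inl g) => if tm_accept g.1.1 then (0, 0) else (1, 1)
  | inr (inr false) => (1, (2 * T).+1)
  | inr (inr true) => (1, T)
  end.

Definition grid (B : finType) (range : B -> nat * nat) : seq (B * (nat * nat)) :=
  [seq (a, p) | a <- enum B, p <- [seq (t, c) | t <- iota 0 (range a).1, c <- iota 0 (range a).2]].

Lemma mem_grid (B : finType) (range : B -> nat * nat) a t c :
  ((a, (t, c)) \in grid range) = (t < (range a).1) && (c < (range a).2).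
Proof.
apply/allpairsPdep/idP => [[a' [p [_ /allpairsP[[t' c'] /= [Ht Hc ->]] [-> -> ->]]]]|/andP[Ht Hc]].
  by move: Ht Hc; rewrite !mem_iota !add0n /= => -> ->.
exists a, (t, c); split=> //; first by rewrite mem_enum.
by apply/allpairsP; exists (t, c); rewrite /= !mem_iota !add0n.
Qed.

Lemma grid_uniq (B : finType) (range : B -> nat * nat) : uniq (grid range).
Proof.
apply: allpairs_uniq_dep; first exact: enum_uniq.
  move=> a _; apply: allpairs_uniq; rewrite ?iota_uniq //.
  by move=> [t c] [t' c'] _ _ [-> ->].
by move=> [a p] [b q] _ _ /= [-> ->].
Qed.

Definition variables : seq variable := grid var_range.
Definition clauses : seq clause := grid clause_range.

Definition tableau (u : word) (t c : nat) : column := column_of (run M t [:: x; u]) c.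

Lemma tableau_next u t c : 0 < c ->
  tableau u t.+1 c = next_column (tableau u t T) (tableau u t c.-1) (tableau u t c)
    (tableau u t c.+1).
Proof. by move=> c_gt0; rewrite /tableau /run iterS column_of_step. Qed.

Lemma cell_word w c : cell (tape_of_word A w) c = word_cell w c.
Proof. by rewrite /cell /word_cell /= nth_nil. Qed.

Lemma tableau0 u c : tableau u 0 c =
  (tm_start M, [ffun i : 'I_K.+2 => word_cell (nth [::] [:: x; u] i) c], c == T).
Proof. by congr (_, _, _); apply/ffunP => i; rewrite !ffunE cell_word. Qed.

Lemma word_cell_nil c : word_cell [::] c = None.
Proof. by rewrite /word_cell nth_nil if_same. Qed.

(** The certificate tape is the only part of the first row that [initial_column] leaves open. *)
Lemma initial_column_eq g u c : initial_column g c -> g.1.2 second = word_cell u c ->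
  g = tableau u 0 c.
Proof.
case: g => [[q f] m] /and5P[/eqP /= -> /eqP -> /eqP f0 _ /forallP f2] f1.
rewrite tableau0; congr (_, _, _); apply/ffunP => i; rewrite ffunE.
case: i => [[|[|i]] lt_i].
- by rewrite -f0; congr (f _); apply: ord_inj.
- by rewrite -f1; congr (f _); apply: ord_inj; rewrite inordK.
- have /= := f2 (Ordinal lt_i); rewrite nth_nil word_cell_nil => /eqP; apply.
Qed.

Lemma tableau_initial u c : size u <= r -> initial_column (tableau u 0 c) c.
Proof.
move=> le_u; rewrite tableau0; apply/and5P; split; rewrite ?eqxx //= ?ffunE //.
  rewrite inordK //= /word_cell; case: (leqP T c) => //= le_Tc.
  have [lt_c|ge_c] := ltnP (c - T) (size u).
    by rewrite (nth_map false) // (_ : c < T + r) ?andbT; [case: nth | lia].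
  by rewrite nth_default ?size_map.
apply/forallP => -[[|[|i]] lt_i] //=.
by rewrite ffunE /= nth_nil word_cell_nil.
Qed.

Lemma tableau_second u c : (tableau u 0 c).1.2 second = word_cell u c.
Proof. by rewrite tableau0 /= ffunE inordK. Qed.

Lemma accepting_satisfiable u : size u <= r -> accepting (run M T [:: x; u]) ->
  satisfies variables clauses occurs
    (fun i : variable => if i is (Some g, (t, c)) then g == tableau u t c else false).
Proof.
move=> le_u acc; set a := fun i => _.
have var_mem g t c : t <= T -> c <= 2 * T -> (Some g, (t, c)) \in variables.
  by move=> le_t le_c; rewrite mem_grid /= !ltnS le_t.
move=> [[[[[g0 g1] g2] g3]|[g|[]]] [t c]]; rewrite mem_grid /= => /andP[Ht Hc].
(* A premise that differs from the actual column makes its negative literal true; if all four agree,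
   the conclusion is the actual next column. *)
- have neg c' g : c' <= 2 * T -> g != tableau u t c' ->
      (t == t) && [|| (c' == T) && (g == g0), (c' == c) && (g == g1),
                      (c' == c.+1) && (g == g2) | (c' == c.+2) && (g == g3)] ->
      exists2 i, i \in variables & occurs (inl (g0, g1, g2, g3), (t, c)) i (a i).
    move=> le_c' ne oc; exists (Some g, (t, c')); first by rewrite var_mem // ltnW.
    by rewrite /= (negbTE ne).
  have [E0|ne] := eqVneq g0 (tableau u t T); last by apply: (neg T g0); rewrite ?eqxx //; lia.
  have [E1|ne] := eqVneq g1 (tableau u t c).
    have [E2|ne] := eqVneq g2 (tableau u t c.+1).
      have [E3|ne] := eqVneq g3 (tableau u t c.+2).
        exists (Some (tableau u t.+1 c.+1), (t.+1, c.+1)); first by apply: var_mem; lia.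
        by rewrite /= !eqxx E0 E1 E2 E3 tableau_next //= eqxx.
      by apply: (neg c.+2 g3) => //; [lia | rewrite !eqxx !orbT].
    by apply: (neg c.+1 g2) => //; [lia | rewrite !eqxx !orbT].
  by apply: (neg c g1) => //; [lia | rewrite !eqxx !orbT].
- exists (Some g, (T, T)); first by apply: var_mem => //; lia.
  rewrite /= !eqxx !andbT; apply: contraL acc => /eqP Eg.
  by move: Ht; rewrite Eg /tableau /=; rewrite /accepting; case: tm_accept.
- case: (boolP (blank (tableau u 0 (T + c)))) => bl.
    have bl1 : blank (tableau u 0 (T + c).+1).
      move: bl; rewrite /blank !tableau_second /word_cell leq_addr addKn -addnS leq_addr addKn.
      case: (ltnP c (size u)) => lt_c; first by rewrite (nth_map false).
      by move=> _; rewrite nth_default // size_map leqW.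
    exists (Some (tableau u 0 (T + c).+1), (0, (T + c).+1)); first by apply: var_mem; lia.
    by rewrite /= eqxx bl1 addn1 eqxx tableau_initial.
  (* Erasing the certificate symbol gives the blank initial column of this position. It is absent
     from the run, so its negative literal is true. *)
  pose g : column := ((tableau u 0 (T + c)).1.1,
    [ffun i => if i == second then None else (tableau u 0 (T + c)).1.2 i], (tableau u 0 (T + c)).2).
  have blg : blank g by rewrite /blank /= ffunE eqxx.
  exists (Some g, (0, T + c)); first by apply: var_mem; lia.
  have -> : a (Some g, (0, T + c)) = false.
    by apply: contraNF bl => /eqP <-.
  rewrite /= addn0 eqxx blg /=.
  have /and5P[H1 H2 H3 H4 /forallP H5] := tableau_initial (T + c) le_u.
  apply/and5P; split=> //=.
  + by rewrite ffunE ifN // -val_eqE /= inordK.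
  + by rewrite ffunE eqxx.
  + by apply/forallP => i; rewrite ffunE; case: (i == second); rewrite ?eqxx ?implybT.
- exists (Some (tableau u 0 c), (0, c)); first by apply: var_mem => //; lia.
  by rewrite /= !eqxx tableau_initial.
Qed.

(** The certificate is read off the assignment: it ends at the first position that holds a blank,
    and before that a bit is true when a column with [true] is present there. Its run is then
    contained in the assignment, so a nonaccepting last state would violate a final clause. *)
Lemma satisfiable_accepting a : satisfies variables clauses occurs a ->
  exists2 u, size u <= r & accepting (run M T [:: x; u]).
Proof.
move=> sat.
have init c : c <= 2 * T -> exists2 g, initial_column g c & a (Some g, (0, c)).
  move=> le_c; have := sat (inr (inr false), (0, c)); rewrite mem_grid /= ltnS le_c.
  move=> /(_ isT) [[[g|] [t' c']] _ //= /and4P[ag /eqP Et /eqP Ec ini]].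
  by exists g; rewrite -?Et -?Ec.
pose val_at v j := [exists g : column,
  [&& initial_column g (T + j), g.1.2 second == v & a (Some g, (0, T + j))]].
have mono j : j < T -> val_at None j -> val_at None j.+1.
  move=> lt_j /existsP[g /and3P[ini bl ag]].
  have := sat (inr (inr true), (0, j)); rewrite mem_grid /= lt_j => /(_ isT).
  case=> [[[g'|] [t' c']] _ //= /and4P[bl' /eqP Et /eqP Ec ini']]; subst t'.
  case Ea: (a _) Ec => Ec.
    by apply/existsP; exists g'; rewrite addnS -addn1 -Ec ini' Ea andbT.
  rewrite addn0 in Ec; subst c'.
  (* The negative literal of the clause belongs to the only blank initial column, which is [g] and
     is true. *)
  have ug h : initial_column h (T + j) -> blank h -> h = tableau [::] 0 (T + j).
    by move=> ih /eqP bh; apply: initial_column_eq ih _; rewrite bh word_cell_nil.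
  by rewrite (ug g') // -(ug g) // ag in Ea.
have blank_ge j : r <= j -> j <= T -> val_at None j.
  move=> ge_j le_j; have [|g ini ag] := init (T + j); first by lia.
  apply/existsP; exists g; rewrite ini ag andbT.
  have /and5P[_ _ _ H _] := ini; move: H; rewrite (_ : T + j < T + r = false) ?andbF ?orbF //.
  by lia.
pose l := find (val_at None) (iota 0 r).
have le_l : l <= r by rewrite -[r in _ <= r](size_iota 0); apply: find_size.
have before j : j < l -> ~~ val_at None j.
  move=> lt_j; have := before_find 0 lt_j; rewrite nth_iota ?add0n => [->//|].
  exact: leq_trans le_l.
have after j : l <= j -> j <= T -> val_at None j.
  move=> le_lj; rewrite -(subnKC le_lj); elim: (j - l) => [|m IHm] le_T; last first.
    by rewrite addnS; apply: mono; [lia | apply: IHm; lia].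
  rewrite addn0 in le_T *; have [lt_l|ge_l] := ltnP l r; last exact: blank_ge.
  have := @nth_find _ 0 (val_at None) (iota 0 r).
  by rewrite has_find size_iota -/l lt_l nth_iota //; apply.
pose u := mkseq (val_at (Some (inl true))) l.
have size_u : size u = l by rewrite size_mkseq.
have base c : c <= 2 * T -> a (Some (tableau u 0 c), (0, c)).
  move=> le_c; have [lt_c|ge_c] := ltnP c T.
    have [g ini ag] := init c le_c.
    rewrite -(initial_column_eq ini) // /word_cell leqNgt lt_c /=.
    have /and5P[_ _ _ H _] := ini; move: H; rewrite (_ : T <= c < T + r = false) ?andbF ?orbF.
      by move/eqP.
    by rewrite leqNgt lt_c.
  have Ec : c = T + (c - T) by rewrite subnKC.
  have Eu : word_cell u c = nth None [seq Some (inl b) | b <- u] (c - T).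
    by rewrite /word_cell ge_c.
  have [lt_l|ge_l] := ltnP (c - T) l; last first.
    have /existsP[g] := after _ ge_l ltac:(lia).
    rewrite -Ec => /and3P[ini /eqP bl ag].
    by rewrite -(initial_column_eq ini) // bl Eu nth_default // size_map size_u.
  rewrite (nth_map false) ?size_u // nth_mkseq // in Eu.
  case Ev: (val_at _ _) Eu => Eu.
    have /existsP[g] := Ev; rewrite /= -Ec => /and3P[ini /eqP f1 ag].
    by rewrite -(initial_column_eq ini) // f1 Eu.
  have [g ini ag] := init c le_c.
  rewrite -(initial_column_eq ini) // Eu.
  have /and5P[_ _ _ /orP[bl|/andP[/orP[/eqP tr|/eqP->//] _]] _] := ini.
    case/existsP: (before _ lt_l); exists g; rewrite /= -Ec; exact/and3P.
  by case/existsP: (negbT Ev); exists g; rewrite /= -Ec; apply/and3P; split=> //; apply/eqP.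
(* The columns at the ends of the array have no rule, so each step loses one on either side. At time
   [T] the origin alone is left, which is all that the final clauses need. *)
have step t : t <= T -> forall c, t <= c -> c + t <= 2 * T -> a (Some (tableau u t c), (t, c)).
  elim: t => [|t IHt] lt_t c le_c le_T; first by apply: base; lia.
  have := sat (inl (tableau u t T, tableau u t c.-1, tableau u t c, tableau u t c.+1), (t, c.-1)).
  rewrite mem_grid /= lt_t /= (_ : c.-1 < _); last by lia.
  move=> /(_ isT) [[[g|] [t' c']] _ //=]; case Ea: (a _).
    move=> /and3P[/eqP Et /eqP Ec /eqP Eg].
    by rewrite tableau_next; [rewrite -Eg -Et (_ : c = c') // Ec; lia | lia].
  have prev c0 : t <= c0 -> c0 + t <= 2 * T ->
      (Some g, (t', c')) <> (Some (tableau u t c0), (t, c0)).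
    by move=> ge0 le0 E; rewrite E IHt in Ea => //; lia.
  move=> /andP[/eqP Et] /or4P[] /andP[/eqP Ec /eqP Eg]; move: prev; rewrite Et Ec Eg.
  - by move=> /(_ T ltac:(lia) ltac:(lia)) [].
  - by move=> /(_ c.-1 ltac:(lia) ltac:(lia)) [].
  - by rewrite prednK; [move=> /(_ c ltac:(lia) ltac:(lia)) [] | lia].
  - by rewrite prednK; [move=> /(_ c.+1 ltac:(lia) ltac:(lia)) [] | lia].
exists u; first by rewrite size_u.
apply: contraT => nacc.
have := sat (inr (inl (tableau u T T)), (0, 0)); rewrite mem_grid /= -[tm_accept _]/(accepting _).
rewrite (negbTE nacc) => /(_ isT) [[[g|] [t' c']] _ //= /and4P[na /eqP Et /eqP Ec /eqP Eg]].
by rewrite Et Ec Eg step ?leqnn // in na; lia.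
Qed.

End Tableau.

(** * Binary numerals and the encoding of instances *)

Lemma nth_binary p i : 0 < p -> nth false (binary p) i = odd (p %/ 2 ^ i).
Proof.
move=> p_gt0; rewrite /binary; case: (ltnP i (trunc_log 2 p).+1) => [lt_i|ge_i].
  by rewrite nth_mkseq.
rewrite nth_default ?size_mkseq // divn_small //.
by apply: leq_trans (trunc_log_ltn p (isT : 1 < 2)) _; rewrite leq_exp2l.
Qed.

Lemma binary_inj p q : 0 < p -> 0 < q -> binary p = binary q -> p = q.
Proof.
move=> p_gt0 q_gt0 E.
have {E p_gt0 q_gt0} : forall i, odd (p %/ 2 ^ i) = odd (q %/ 2 ^ i).
  by move=> i; rewrite -!nth_binary // E.
have [n] := ubnP p; elim: n p q => // n IHn p q lt_p E.
have E0 := E 0; rewrite expn0 !divn1 in E0.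
have Eh : p %/ 2 = q %/ 2.
  have [p0|p_gt0] := posnP p.
    have [q0|q_gt0] := posnP q; first by rewrite p0 q0.
    have := E (trunc_log 2 q); rewrite p0 div0n.
    have /andP[le1 lt2] := trunc_log_bounds (isT : 1 < 2) q_gt0.
    rewrite (_ : q %/ _ = 1) //; apply/eqP; rewrite eqn_leq -ltnS.
    by rewrite ltn_divLR ?expn_gt0 // -expnS lt2 divn_gt0 ?expn_gt0.
  apply: IHn => [|i]; first by have := ltn_Pdiv (isT : 1 < 2) p_gt0; lia.
  by rewrite -!divnMA -expnS E.
by rewrite -(odd_double_half p) -(odd_double_half q) E0 -!divn2 Eh.
Qed.

(** Every divisor is 1 or even: a characterisation of powers of two with bounded quantifiers and no
    exponentiation. *)
Definition is_pow2 (z : nat) : bool :=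
  ~~ has (fun d => has (fun e => d * e == z) (iota 0 z.+1) &&
                  ~~ ((d == 1) || has (fun h => d == h + h) (iota 0 d.+1))) (iota 0 z.+1).

(** The odd part of [z] is a divisor, so the condition forces it to be 1. *)
Lemma is_pow2P z : 0 < z -> reflect (exists i, z = 2 ^ i) (is_pow2 z).
Proof.
move=> z_gt0; apply: (iffP idP) => [/hasPn H|[i ->]]; last first.
  apply/hasPn => d _; rewrite negb_and negbK; apply/orP; case: hasP => [|_]; [|by left].
  case=> e _ /eqP Ede; right.
  have /dvdn_pfactor : d %| 2 ^ i by rewrite -Ede dvdn_mulr.
  move=> /(_ isT) [[|m] _ ->] //; apply/orP; right; apply/hasP; exists (2 ^ m).
    by rewrite mem_iota /= add0n ltnS leq_exp2l.
  by rewrite addnn expnS mul2n.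
exists (logn 2 z); have Ez := partnC 2 z_gt0; rewrite p_part in Ez.
suff : z`_2^' = 1 by move=> E; rewrite -{1}Ez E muln1.
have lt_m : z`_2^' < z.+1 by rewrite ltnS dvdn_leq // dvdn_part.
have := H (z`_2^'); rewrite mem_iota => /(_ lt_m); cbv beta.
have -> : has (fun e => z`_2^' * e == z) (iota 0 z.+1).
  apply/hasP; exists (2 ^ logn 2 z); last by rewrite mulnC Ez.
  by rewrite mem_iota /= add0n ltnS -p_part dvdn_leq // dvdn_part.
rewrite andTb negbK => /orP[/eqP //|/hasP[h _ /eqP Eh]].
have := part_pnat 2^' z; rewrite p'natE // Eh addnn -muln2 dvdn_mull //.
Qed.

(** The digits are indexed by the powers of two up to [p] instead of by exponents. Ranging over all
    numbers below [p] is affordable because the reduction produces a polynomially bounded [p]. *)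
Lemma binary_pow2 p : 0 < p ->
  binary p = flatten [seq if is_pow2 z.+1 then [:: odd (p %/ z.+1)] else [::] | z <- iota 0 p].
Proof.
move=> p_gt0.
have -> : [seq if is_pow2 z.+1 then [:: odd (p %/ z.+1)] else [::] | z <- iota 0 p]
    = [seq if is_pow2 z then [:: odd (p %/ z)] else [::] | z <- iota 1 p].
  by rewrite -[1]addn0 iotaDl -map_comp.
have flat (s : seq nat) : flatten [seq if is_pow2 z then [:: odd (p %/ z)] else [::] | z <- s]
    = [seq odd (p %/ z) | z <- s & is_pow2 z].
  by elim: s => //= z s ->; case: ifP.
rewrite flat (_ : [seq z <- iota 1 p | is_pow2 z] = [seq 2 ^ i | i <- iota 0 (trunc_log 2 p).+1]).
  by rewrite -map_comp.
apply: (irr_sorted_eq ltn_trans ltnn).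
- by rewrite sorted_filter ?iota_ltn_sorted //; apply: ltn_trans.
- rewrite sorted_map; apply: sub_sorted (iota_ltn_sorted 0 _) => i j /=.
  by rewrite ltn_exp2l.
move=> z; rewrite mem_filter mem_iota add1n ltnS; apply/andP/mapP.
  move=> [pow /andP[z_gt0 le_z]]; have [i Ez] := is_pow2P z_gt0 pow.
  by exists i => //; rewrite mem_iota /= ltnS trunc_log_max // -Ez.
move=> [i]; rewrite mem_iota /= add0n ltnS => le_i ->; split.
  by apply/is_pow2P; [rewrite expn_gt0 | exists i].
rewrite expn_gt0 /=; apply: leq_trans (trunc_logP (isT : 1 < 2) p_gt0).
by rewrite leq_exp2l.
Qed.

(** The relations have different types until [n = n'] is known, so the conclusion compares the two
    cover statements. The first [false] determines [n]. *)
Lemma encode_inj n (e : rel 'I_n) p n' (e' : rel 'I_n') p' :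
  0 < p -> 0 < p' -> encode e p = encode e' p' ->
  n = n' /\ has_m_convex_cover e p = has_m_convex_cover e' p'.
Proof.
move=> p_gt0 p'_gt0 E.
have idx m w : index false (nseq m true ++ false :: w) = m.
  by elim: m => //= m ->.
have En : n = n' by rewrite -(idx n ([seq e i j | i <- enum 'I_n, j <- enum 'I_n] ++ binary p))
  -[X in index _ X]/(encode e p) E idx.
subst n'; split=> //; move/eqP: E; rewrite /encode eqseq_cat // eqxx /= eqseq_cons eqxx /=.
rewrite eqseq_cat ?size_allpairs // => /andP[/eqP Ee /eqP /binary_inj ->] //.
congr has_m_convex_cover; apply: functional_extensionality => i.
apply: functional_extensionality => j.
by apply: (eq_in_allpairs e e' (enum 'I_n) (enum 'I_n)).2 => //; rewrite mem_enum.
Qed.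

(** * Programs for instances *)

Definition Or (f g : form) : form := Not (And (Not f) (Not g)).
Definition Truth (b : bool) : form := Lt (Cst 0) (Cst b).

Section InstancePrograms.

Variable wd : bool -> word.

Notation evalT := (evalT wd).
Notation evalF := (evalF wd).
Notation evalG := (evalG wd).

Lemma evalF_Or r f g : evalF r (Or f g) = evalF r f || evalF r g.
Proof. by rewrite /= negb_and !negbK. Qed.

Lemma evalF_Truth r b : evalF r (Truth b) = b.
Proof. by case: b. Qed.

Definition poly_term (q : seq nat) (t : term) : term :=
  foldr (fun a s => Add (Mul s t) (Cst a)) (Cst 0) q.

Lemma evalT_poly r (q : {poly nat}) t : evalT r (poly_term q t) = q.[evalT r t]%R.
Proof. by rewrite /horner; elim: (polyseq q) => //= a s ->. Qed.

Section Grids.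

Variables (B : finType) (ranges : B -> term * term) (range : B -> nat * nat).
Hypothesis range1 : forall b r, evalT r (ranges b).1 = (range b).1.
Hypothesis range2 : forall b r, evalT r (ranges b).2 = (range b).2.

(** The tags depend on the machine alone and are unrolled into the program; only positions are
    looped over. *)
Definition grid_gen (body : B -> gen) : gen :=
  foldr (fun b g => Cat (For (ranges b).1 (For (ranges b).2 (body b))) g) Nil (enum B).

Definition grid_size : term :=
  foldr (fun b t => Add (Mul (ranges b).1 (ranges b).2) t) (Cst 0) (enum B).

Lemma evalT_grid_size r : evalT r grid_size = size (grid range).
Proof.
rewrite /grid_size /grid; elim: (enum B) => //= b s ->.
by rewrite size_cat size_map size_allpairs !size_iota range1 range2.
Qed.

Lemma evalG_grid r body : evalG r (grid_gen body) =
  flatten [seq evalG (rcons (rcons r x.2.1) x.2.2) (body x.1) | x <- grid range].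
Proof.
rewrite /grid_gen /grid; elim: (enum B) => //= b s ->.
rewrite map_cat flatten_cat; congr (_ ++ _); rewrite range1.
elim: (iota 0 (range b).1) => //= t ts ->.
by rewrite !map_cat flatten_cat range2 -!map_comp.
Qed.

End Grids.

Definition pow2_form (z : term) (d : nat) : form :=
  let s := Add z (Cst 1) in
  Not (Ex s (And (Ex s (Eq (Mul (Var d) (Var d.+1)) z))
                 (Not (Or (Eq (Var d) (Cst 1))
                          (Ex (Add (Var d) (Cst 1)) (Eq (Var d) (Add (Var d.+1) (Var d.+1)))))))).

(** The digit of weight [z] is 1 when the value of [P] is [(2q + 1) z + s] with [s < z]. *)
Definition bit_form (P z : term) (d : nat) : form :=
  Ex (Add P (Cst 1)) (Ex z
    (Eq P (Add (Mul (Add (Add (Var d) (Var d)) (Cst 1)) z) (Var d.+1)))).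

Definition binary_gen (P : term) : gen :=
  let z := Add (Var 0) (Cst 1) in For P (If (pow2_form z 1) (Out (bit_form P z 1))).

Lemma evalF_pow2 z : evalF [:: z] (pow2_form (Add (Var 0) (Cst 1)) 1) = is_pow2 z.+1.
Proof.
rewrite /= !addn1 /is_pow2; congr negb; apply: eq_has => d.
by rewrite /= !addn1 !negbK negb_or.
Qed.

Lemma evalF_bit P p z : (forall r, evalT r P = p) ->
  evalF [:: z] (bit_form P (Add (Var 0) (Cst 1)) 1) = odd (p %/ z.+1).
Proof.
move=> EP; rewrite /= EP !addn1; apply/hasP/idP => [[q _ /hasP[s]]|odd_pz].
  rewrite mem_iota /= => lt_s /eqP Ep; rewrite EP !addn1 in Ep lt_s.
  by rewrite Ep divnMDl // divn_small // addn0 /= oddD addbb.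
exists (p %/ z.+1)./2.
  rewrite mem_iota /= add0n ltnS; apply: leq_trans (leq_div p z.+1).
  by rewrite -divn2 leq_div.
apply/hasP; exists (p %% z.+1); first by rewrite mem_iota /= ?addn1 ltn_mod.
rewrite /= EP !addn1 addnn {1}(divn_eq p z.+1); apply/eqP; congr (_ * _ + _).
by rewrite -[LHS]odd_double_half odd_pz.
Qed.

Lemma evalG_binary P p : 0 < p -> (forall r, evalT r P = p) ->
  evalG [::] (binary_gen P) = binary p.
Proof.
move=> p_gt0 EP; rewrite binary_pow2 //.
have -> : iota 0 p = iota 0 (evalT [::] P) by rewrite EP.
congr flatten; apply: eq_map => z.
by rewrite -evalF_pow2 -(evalF_bit z EP).
Qed.

End InstancePrograms.

(** * The reduction *)

Section Reduction.

(* [length_term] stands for [T.-1]: the language has no subtraction. *)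
Variables (M : turing_machine) (length_term cert_term : term).

Notation column := (column M).
Notation A := (tm_aux M).

Let T_term := Add length_term (Cst 1).

Definition var_terms (o : option column) : term * term :=
  if o is Some _ then (Add T_term (Cst 1), Add (Mul (Cst 2) T_term) (Cst 1))
  else (Cst 1, Cst 1).

Definition clause_terms (k : clause_tag M) : term * term :=
  match k with
  | inl _ => (T_term, Add (Mul (Cst 2) length_term) (Cst 1))
  | inr (inl g) => if tm_accept g.1.1 then (Cst 0, Cst 0) else (Cst 1, Cst 1)
  | inr (inr false) => (Cst 1, Add (Mul (Cst 2) T_term) (Cst 1))
  | inr (inr true) => (Cst 1, T_term)
  end.

Definition vertex_tag : finType :=
  ((option column * option bool) + (clause_tag M + bool))%type.

Definition vertex_terms (k : vertex_tag) : term * term :=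
  match k with
  | inl (o, _) => var_terms o
  | inr (inl k) => clause_terms k
  | inr (inr _) => (Cst 1, Cst 1)
  end.

Definition vertex_range (T : nat) (k : vertex_tag) : nat * nat :=
  match k with
  | inl (o, _) => var_range T o
  | inr (inl k) => clause_range T k
  | inr (inr _) => (1, 1)
  end.

Definition to_vertex (y : vertex_tag * (nat * nat)) : vertex (variable M) (clause M) :=
  match y.1 with
  | inl (o, b) => inl ((o, y.2), b)
  | inr (inl k) => inr (inl (k, y.2))
  | inr (inr b) => inr (inr b)
  end.

(* The forms below are evaluated in environments of length 4, that give the
   positions of two vertices; variables are referred to by their numbers. *)
Definition word_form (s : option (bool + A)) (i : nat) : form :=
  let at_v := Eq (Var i) (Add T_term (Var 4)) in
  match s with
  | None => Not (Ex (Len false) at_v)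
  | Some (inl b) => Ex (Len false)
      (And at_v (if b then Bit false (Var 4) else Not (Bit false (Var 4))))
  | Some (inr _) => Truth false
  end.

Definition initial_form (g : column) (i : nat) : form :=
  And (Truth (g.1.1 == tm_start M))
  (And (if g.2 then Eq (Var i) T_term else Not (Eq (Var i) T_term))
  (And (word_form (g.1.2 ord0) i)
  (And (Or (Truth (g.1.2 (second M) == None))
           (And (Truth ((g.1.2 (second M) == Some (inl true)) ||
                        (g.1.2 (second M) == Some (inl false))))
                (And (Not (Lt (Var i) T_term)) (Lt (Var i) (Add T_term cert_term)))))
       (Truth [forall i : 'I_(tm_tapes M).+2, (1 < i) ==> (g.1.2 i == None)])))).

Definition occurs_form (k : clause_tag M) (t c : nat) (o : option column) (t' c' : nat)
    (b : bool) : form :=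
  match o with
  | None => Truth false
  | Some g =>
    match k with
    | inl (g0, g1, g2, g3) =>
        if b then And (Eq (Var t') (Add (Var t) (Cst 1)))
                 (And (Eq (Var c') (Add (Var c) (Cst 1)))
                      (Truth (g == next_column g0 g1 g2 g3)))
        else And (Eq (Var t') (Var t))
             (Or (And (Eq (Var c') T_term) (Truth (g == g0)))
             (Or (And (Eq (Var c') (Var c)) (Truth (g == g1)))
             (Or (And (Eq (Var c') (Add (Var c) (Cst 1))) (Truth (g == g2)))
                 (And (Eq (Var c') (Add (Var c) (Cst 2))) (Truth (g == g3))))))
    | inr (inl g0) =>
        And (Truth (~~ b)) (And (Eq (Var t') T_term)
        (And (Eq (Var c') T_term) (Truth (g == g0))))
    | inr (inr false) =>
        And (Truth b) (And (Eq (Var t') (Cst 0))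
        (And (Eq (Var c') (Var c)) (initial_form g c')))
    | inr (inr true) =>
        And (Truth (blank g)) (And (Eq (Var t') (Cst 0))
        (And (Eq (Var c') (Add (Add T_term (Var c)) (Cst b))) (initial_form g c')))
    end
  end.

Definition same_position : form := And (Eq (Var 0) (Var 2)) (Eq (Var 1) (Var 3)).

Definition adjacent_form (k l : vertex_tag) : form :=
  match k, l with
  | inl (_, None), inl (_, None) => Truth false
  | inl (o, None), inl (o', Some _) => And (Truth (o == o')) same_position
  | inl (o, Some _), inl (o', None) => And (Truth (o == o')) same_position
  | inl (o, Some _), inl (o', Some _) => Not (And (Truth (o == o')) same_position)
  | inl (_, None), inr (inl _) => Truth true
  | inr (inl _), inl (_, None) => Truth true
  | inl (o, Some b), inr (inl k) => occurs_form k 2 3 o 0 1 b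
  | inr (inl k), inl (o, Some b) => occurs_form k 0 1 o 2 3 b
  | inr (inl k), inr (inl l) => Not (And (Truth (k == l)) same_position)
  | inr (inr _), inr (inr _) => Truth false
  | inr (inr _), _ => Truth true
  | _, inr (inr _) => Truth true
  end.

Let cover_term := Add (grid_size var_terms) (Cst 1).

Definition instance_gen : gen :=
  Cat (grid_gen vertex_terms (fun=> Out (Truth true)))
  (Cat (Out (Truth false))
  (Cat (grid_gen vertex_terms (fun k => grid_gen vertex_terms (fun l => Out (adjacent_form k l))))
       (binary_gen cover_term))).

Variables (x : word) (T r : nat).
Notation evalT := (evalT (fun=> x)).
Notation evalF := (evalF (fun=> x)).
Notation evalG := (evalG (fun=> x)).
Hypothesis T_gt0 : 0 < T.
Hypothesis evalT_length : forall e, evalT e length_term = T.-1.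
Hypothesis evalT_cert : forall e, evalT e cert_term = r.

Lemma evalT_T e : evalT e T_term = T.
Proof. by rewrite /= evalT_length addn1 prednK. Qed.

Lemma evalT_var_terms o e : evalT e (var_terms o).1 = (var_range T o).1 /\
  evalT e (var_terms o).2 = (var_range T o).2.
Proof. by case: o => //= g; rewrite !evalT_length; lia. Qed.

Lemma evalT_clause_terms k e : evalT e (clause_terms k).1 = (clause_range T k).1 /\
  evalT e (clause_terms k).2 = (clause_range T k).2.
Proof.
case: k => [g|[g|[]]] /=; rewrite ?evalT_length; try lia.
by case: ifP.
Qed.

Lemma evalT_vertex_terms k e : evalT e (vertex_terms k).1 = (vertex_range T k).1 /\
  evalT e (vertex_terms k).2 = (vertex_range T k).2.
Proof.
by case: k => [[o b]|[k|b]] //=; [apply: evalT_var_terms | apply: evalT_clause_terms].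
Qed.

Lemma evalF_word s i e : size e = 4 -> i < 4 ->
  evalF e (word_form s i) = (s == word_cell M T x (nth 0 e i)).
Proof.
move=> size_e lt_i; have Ei v : nth 0 (rcons e v) i = nth 0 e i.
  by rewrite nth_rcons size_e lt_i.
have Ev v : nth 0 (rcons e v) 4 = v by rewrite nth_rcons size_e.
have has_x (P : pred nat) : has (fun v => (nth 0 (rcons e v) i ==
      evalT (rcons e v) T_term + nth 0 (rcons e v) 4) && P (nth 0 (rcons e v) 4))
      (iota 0 (size x)) =
    [&& T <= nth 0 e i, nth 0 e i - T < size x & P (nth 0 e i - T)].
  apply/hasP/and3P => [[v]|[le_T lt_x Pc]].
    rewrite mem_iota Ei Ev evalT_T /= => lt_v /andP[/eqP -> Pv].
    by rewrite leq_addr addKn.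
  exists (nth 0 e i - T); first by rewrite mem_iota.
  by rewrite Ei Ev evalT_T subnKC // eqxx.
have out c : T <= c -> ~~ (c - T < size x) -> word_cell M T x c = None :> symbol A.
  by move=> le_T; rewrite -leqNgt /word_cell le_T => ge; rewrite nth_default ?size_map.
have inside c : T <= c -> c - T < size x ->
    word_cell M T x c = Some (inl (nth false x (c - T))) :> symbol A.
  by move=> le_T lt; rewrite /word_cell le_T (nth_map false).
set c := nth 0 e i in has_x *; have before : ~~ (T <= c) -> word_cell M T x c = None :> symbol A.
  by rewrite /word_cell => /negbTE ->.
case: s => [[b|a]|]; last first.
- have := has_x predT; rewrite /=; under eq_has do rewrite andbT.
  move=> ->; rewrite andbT negb_and.
  case: (boolP (T <= c)) => [le_T|/before -> //].
  by case: (boolP (c - T < size x)) => [/(inside _ le_T) ->|/(out _ le_T) ->].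
- rewrite evalF_Truth; apply/esym/negbTE.
  case: (boolP (T <= c)) => [le_T|/before -> //].
  by case: (boolP (c - T < size x)) => [/(inside _ le_T) ->|/(out _ le_T) ->].
have /= := has_x (fun v => nth false x v == b).
have -> : [&& T <= c, c - T < size x & nth false x (c - T) == b] =
    (Some (inl b) == word_cell M T x c :> symbol A).
  case: (boolP (T <= c)) => [le_T|/before -> //].
  case: (boolP (c - T < size x)) => [/(inside _ le_T) -> /=|/(out _ le_T) -> //].
  by rewrite eq_sym.
move=> <-; apply: eq_has => v; case: b => /=; congr andb; first by rewrite eqb_id.
by rewrite eqbF_neg.
Qed.

Lemma evalF_initial g i e : size e = 4 -> i < 4 ->
  evalF e (initial_form g i) = initial_column x T r g (nth 0 e i).
Proof.
move=> size_e lt_i; rewrite /initial_form /initial_column.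
have EA f h : evalF e (And f h) = evalF e f && evalF e h by [].
rewrite !EA evalF_Or !EA !evalF_Truth evalF_word //.
have -> : evalF e (if g.2 then Eq (Var i) T_term else Not (Eq (Var i) T_term)) =
    (g.2 == (nth 0 e i == T)).
  have ET : evalF e (Eq (Var i) T_term) = (nth 0 e i == T) by rewrite -[in RHS](evalT_T e).
  have EN f : evalF e (Not f) = ~~ evalF e f by [].
  by case: g.2; rewrite ?EN ET; case: eqP.
do 4 congr (_ && _).
congr (_ || (_ && _)).
by rewrite /= -leqNgt evalT_length evalT_cert addn1 prednK.
Qed.

Lemma evalF_occurs k t c o t' c' b e : size e = 4 -> t < 4 -> c < 4 -> t' < 4 -> c' < 4 ->
  evalF e (occurs_form k t c o t' c' b) =
  occurs x T r (k, (nth 0 e t, nth 0 e c)) (o, (nth 0 e t', nth 0 e c')) b.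
Proof.
move=> size_e lt_t lt_c lt_t' lt_c'; case: o => [g|//].
have EA f h : evalF e (And f h) = evalF e f && evalF e h by [].
have EE p q : evalF e (Eq p q) = (evalT e p == evalT e q) by [].
case: k => [[[[g0 g1] g2] g3]|[g0|[]]]; rewrite /occurs_form /occurs.
- by case: b; rewrite !(evalF_Or, EA, EE, evalF_Truth, evalT_T) /= ?addn1 ?addn2.
- by rewrite !EA !EE !evalF_Truth !evalT_T.
- by rewrite 3!EA evalF_initial // !(EE, evalF_Truth) /= evalT_length addn1 prednK.
- by rewrite 3!EA evalF_initial // !(EE, evalF_Truth).
Qed.

Lemma evalF_adjacent k l t c t' c' :
  evalF [:: t; c; t'; c'] (adjacent_form k l) =
  adjacent (occurs x T r) (to_vertex (k, (t, c))) (to_vertex (l, (t', c'))).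
Proof.
have EA e f h : evalF e (And f h) = evalF e f && evalF e h by [].
have EN e f : evalF e (Not f) = ~~ evalF e f by [].
case: k l => [[o [b|]]|[k|b]] [[o' [b'|]]|[l|b']] //;
  rewrite /adjacent_form ?EN ?EA ?evalF_Truth ?evalF_occurs //=.
Qed.

(** [to_vertex] forgets the position of a universal vertex, but the range of its tag contains only
    the position (0, 0). *)
Lemma to_vertex_inj : {in grid (vertex_range T) &, injective to_vertex}.
Proof.
move=> [k [t c]] [l [t' c']]; rewrite !mem_grid.
case: k l => [[o b]|[k|b]] [[o' b']|[l|b']] //=; rewrite /to_vertex /=.
- by move=> _ _ [-> -> -> ->].
- by move=> _ _ [-> -> ->].
- by move=> /andP[]; rewrite !ltnS !leqn0 => /eqP -> /eqP -> /andP[/eqP -> /eqP ->] [->].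
Qed.

Definition vertices : seq (vertex (variable M) (clause M)) :=
  [seq to_vertex y | y <- grid (vertex_range T)].

Lemma vertices_uniq : uniq vertices.
Proof. by rewrite map_inj_in_uniq ?grid_uniq //; apply: to_vertex_inj. Qed.

Lemma mem_vertices y : (y \in vertices) = is_vertex (variables M T) (clauses M T) y.
Proof.
apply/mapP/idP => [[[k [t c]]]|].
  by rewrite mem_grid; case: k => [[o b]|[k|b]] /= H ->; rewrite /= ?mem_grid.
case: y => [[[o [t c]] b]|[[k [t c]]|b]] /=; rewrite ?mem_grid => H.
- by exists (inl (o, b), (t, c)); rewrite ?mem_grid.
- by exists (inr (inl k), (t, c)); rewrite ?mem_grid.
- by exists (inr (inr b), (0, 0)); rewrite ?mem_grid.
Qed.

Definition instance_edge (i j : 'I_(size vertices)) : bool :=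
  adjacent (occurs x T r) (nth_vertex vertices i) (nth_vertex vertices j).

Lemma evalG_instance :
  evalG [::] instance_gen = encode instance_edge (size (variables M T)).+1.
Proof.
have range1 k e := (evalT_vertex_terms k e).1.
have range2 k e := (evalT_vertex_terms k e).2.
have map_nth : [seq nth_vertex vertices i | i : 'I_(size vertices) <- enum 'I_(size vertices)]
    = vertices.
  rewrite -[RHS](mkseq_nth (inr (inr false))) /mkseq -val_enum_ord -map_comp.
  exact: eq_map.
have matrix : [seq instance_edge i j | i <- enum 'I_(size vertices), j <- enum 'I_(size vertices)]
    = [seq adjacent (occurs x T r) a b | a <- vertices, b <- vertices].
  by rewrite -[in RHS]map_nth allpairs_mapl allpairs_mapr.
rewrite /encode matrix /instance_gen /=; congr (_ ++ _ :: (_ ++ _)).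
- rewrite (evalG_grid range1 range2) [size vertices]size_map.
  by elim: (grid _) => //= y s ->.
- rewrite (evalG_grid range1 range2) /vertices allpairs_mapl; congr flatten.
  apply: eq_map => -[k [t c]] /=; rewrite (evalG_grid range1 range2) -map_comp.
  rewrite -[RHS]flatten_map1; congr flatten; apply: eq_map => -[l [t' c']].
  congr [:: _]; exact: evalF_adjacent.
- apply: (@evalG_binary _ cover_term) => // e.
  have rv1 o e' := (evalT_var_terms o e').1; have rv2 o e' := (evalT_var_terms o e').2.
  by rewrite /cover_term /= (evalT_grid_size rv1 rv2) addn1.
Qed.

End Reduction.

Lemma polyterm_le (q : {poly nat}) m n : m <= n -> q.[m]%R <= q.[n]%R.
Proof.
move=> le_mn; rewrite /horner; elim: (polyseq q) => //= a s IHs.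
exact: leq_add (leq_mul IHs le_mn) (leqnn a).
Qed.

Lemma run_halted (M : turing_machine) ws m n : m <= n -> halted (run M m ws) ->
  run M n ws = run M m ws.
Proof.
move=> /subnKC <- H; elim: (n - m) => [|k IHk]; first by rewrite addn0.
by rewrite addnS /run iterS -/(run M (m + k) ws) IHk; move: H; rewrite /halted; case: step.
Qed.

Theorem m_convex_cover_hard : NP_hard m_convex_cover_problem.
Proof.
move=> L [R [M [q HM]] [r Hr]].
pose len := Len false; pose cert := poly_term r len.
(* This is [T - 1]. The first summand covers the running time on every admissible certificate, the
   second makes the certificate fit into the right half of the array. *)
pose lt := Add (poly_term q (Add len cert)) cert.
exists (fun x => evalG (fun=> x) [::] (instance_gen M lt cert)).
  exact: gen_polytime.
move=> x; set rx := r.[size x]%R; set T := (q.[size x + rx]%R + rx).+1.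
have Ecert e : evalT (fun=> x) e cert = rx by rewrite evalT_poly.
have Elt e : evalT (fun=> x) e lt = T.-1 by rewrite /= !evalT_poly /= evalT_poly.
rewrite (@evalG_instance M lt cert x T rx) //.
have le_rT : rx <= T by rewrite leqW // leq_addl.
have dvar : (None, (0, 0)) \in variables M T by rewrite mem_grid.
have sat_iff := @m_convex_cover_satisfiable _ _ (variables M T) (clauses M T) (occurs x T rx)
  (grid_uniq _) (None, (0, 0)) dvar (fun _ _ => erefl) (vertices M T) (vertices_uniq M T)
  (@mem_vertices M T).
have acc_iff u : size u <= rx -> R x u <-> accepting (run M T [:: x; u]).
  move=> le_u; have [halt ->] := HM x u; rewrite (@run_halted M _ (q.[size x + size u]%R)) //.
  by rewrite leqW // (leq_trans _ (leq_addr _ _)) // polyterm_le // leq_add2l.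
split=> [/Hr[u le_u /(acc_iff u le_u) acc]|[n [e [p [_ _ le_p Ew cov]]]]].
  exists (size (vertices M T)), (@instance_edge M x T rx), (size (variables M T)).+1; split=> //.
  - by move=> i j; apply: adjacent_sym.
  - by move=> i; apply: adjacent_irr.
  (* The bound [3 <= p] holds as there are two variables, the dummy one and some column. *)
  - pose two : seq (variable M) := [:: (None, (0, 0)); (Some (tableau M x T [::] 0 0), (0, 0))].
    apply: (@uniq_leq_size _ two) => // y; rewrite !inE => /orP[] /eqP -> //.
    by rewrite mem_grid.
  - by apply/sat_iff; eexists; exact: (accepting_satisfiable (ltn0Sn _) le_rT le_u acc).
have [En Ecov] := encode_inj (ltn0Sn _) (ltn_trans (isT : 0 < 2) le_p) Ew.
move: cov; rewrite -Ecov => /sat_iff[a /(satisfiable_accepting (ltn0Sn _) le_rT)[u le_u acc]].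
by apply/Hr; exists u => //; apply/acc_iff.
Qed.

(** * Certificates of convexity *)

Section ConvexityCertificates.

Variables (T : finType) (e : rel T).

(** Cutting a path short along a chord strictly shortens it. As [r] need not be symmetric, only
    forward chords are used and excluded. *)
Lemma chordless_path (r : rel T) c s : path r c s ->
  exists s', [/\ path r c s', uniq (c :: s'), last c s' = last c s &
    forall i j, i.+1 < j -> j < size (c :: s') -> ~~ r (nth c (c :: s') i) (nth c (c :: s') j)].
Proof.
have [n] := ubnP (size s); elim: n s => // n IHn s lt_s rs.
case/shortenP: (rs) => s1 rs1 us1 sub1.
have le1 : size s1 <= size s.
  by apply: uniq_leq_size sub1; case/andP: us1.
pose ok := [forall i : 'I_(size s1).+1, forall j : 'I_(size s1).+1,
  (i.+1 < j) ==> ~~ r (nth c (c :: s1) i) (nth c (c :: s1) j)].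
have [/forallP Hok|] := boolP ok.
  exists s1; split=> // i j lt_ij lt_j.
  have /forallP := Hok (Ordinal (ltn_trans (ltnW lt_ij) lt_j)).
  by move=> /(_ (Ordinal lt_j)) /implyP; apply.
rewrite negb_forall => /existsP[[i lt_i]]; rewrite negb_forall => /existsP[[[|j] lt_j]];
  rewrite //= negb_imply negbK ltnS => /andP[lt_ij rij].
have Ed : drop j s1 = nth c s1 j :: drop j.+1 s1 by rewrite (drop_nth c).
have le_i : i <= size s1 by rewrite -ltnS.
have Ei : last c (take i s1) = nth c (c :: s1) i.
  rewrite (last_nth c) size_take_min (minn_idPl le_i).
  by case: i le_i {lt_i lt_ij rij} => //= i le_i; rewrite nth_take.
have rs2 : path r c (take i s1 ++ drop j s1).
  have := rs1; rewrite -{1}(cat_take_drop i s1) cat_path => /andP[ri _].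
  have := rs1; rewrite -{1}(cat_take_drop j s1) cat_path Ed => /andP[_ /= /andP[_ rj]].
  by rewrite cat_path ri Ei /= rij.
have [|s' [H1 H2 H3 H4]] := IHn _ _ rs2.
  rewrite size_cat size_take_min size_drop (minn_idPl le_i).
  have shorter k : i < j -> j.+1 < k.+1 -> i + (k - j) < k by lia.
  apply: (@leq_trans (size s1)); last exact: leq_ltn_trans le1 lt_s.
  exact: shorter.
exists s'; split=> //; rewrite H3 last_cat Ed /=.
by rewrite -[in RHS](cat_take_drop j s1) last_cat Ed.
Qed.

Hypothesis e_sym : symmetric e.

(* Such a [label] exists if and only if every component of the complement of [S]
   has a clique as its neighbourhood in [S]. *)
Definition convexity_certificate (S : pred T) (label : rel T) : Prop :=
  [/\ forall a, ~~ S a -> label a a,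
      forall a b c, label a b -> e b c -> ~~ S c -> label a c &
      forall a b c d, label a b -> e a c -> e b d -> S c -> S d -> c != d -> e c d].

(** On an induced path that leaves [S], let [v i] be the first vertex outside and [v j] the next one
    inside. The closure conditions relate [v i] to [v j.-1], and the clique condition yields a chord
    from [v i.-1] to [v j]. *)
Lemma certificate_m_convex (S : {set T}) label :
  convexity_certificate (mem S) label -> m_convex e S.
Proof.
move=> [C1 C2 C3] x s [px us ind] xS lS; apply/allP; apply: contraT => /allPn[w w_s wS].
pose v i := nth x (x :: s) i.
have vE i : i < size s -> e (v i) (v i.+1) by move=> lt_i; move/pathP: px; apply.
have v_last : v (size s) = last x s by rewrite /v (last_nth x).
pose out i := v i \notin S.
have ex_i : exists i, (i <= size s) && out i.
  by exists (index w (x :: s)); rewrite -ltnS index_mem w_s /out /v nth_index.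
case: (ex_minnP ex_i) => i /andP[le_i out_i] min_i.
have i_gt0 : 0 < i by case: i out_i {le_i min_i} => //; rewrite /out /v /= xS.
have in_pred : v i.-1 \in S.
  apply: contraT => H; have := min_i i.-1; rewrite /out H andbT; lia.
have ex_j : exists j, (i < j) && ((j <= size s) && ~~ out j).
  exists (size s); rewrite leqnn /out v_last negbK lS !andbT.
  rewrite ltn_neqAle le_i andbT; apply: contraNneq out_i => ->.
  by rewrite v_last.
case: (ex_minnP ex_j) => j /and3P[lt_ij le_j]; rewrite negbK => in_j min_j.
have lab k : i + k < j -> label (v i) (v (i + k)).
  elim: k => [|k IHk] lt_k; first by rewrite addn0; apply: C1.
  rewrite addnS in lt_k *; have lt_k' := ltnW lt_k.
  apply: (C2 _ (v (i + k))); [exact: IHk | exact/vE/(leq_trans lt_k' le_j) | ].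
  apply/negP => in_k; have : j <= (i + k).+1.
    apply: min_j; rewrite /out negbK ltnS leq_addr (leq_trans lt_k' le_j) /=.
    exact: in_k.
  by rewrite leqNgt lt_k.
have j_gt0 : 0 < j := ltn_trans i_gt0 lt_ij.
have : e (v i.-1) (v j).
  apply: (C3 (v i) (v j.-1)) => //.
  - have le_ij : i <= j.-1 by rewrite -ltnS prednK.
    by have := lab (j.-1 - i); rewrite subnKC //; apply; rewrite prednK.
  - by rewrite e_sym -{2}(prednK i_gt0) vE // prednK.
  - by rewrite -[in v j](prednK j_gt0) vE // prednK.
  - rewrite /v nth_uniq //= ?ltnS // ?(leq_trans (leq_pred _)) //.
    by rewrite ltn_eqF // (leq_ltn_trans (leq_pred _)).
apply: contraTT => _; apply: ind => /=; last by rewrite ltnS.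
by rewrite prednK.
Qed.

(** If [c] and [d] were nonadjacent neighbours of one component outside [S], a shortest connection
    through it would be an induced path that contradicts convexity. *)
Lemma m_convex_certificate (S : {set T}) : m_convex e S ->
  convexity_certificate (mem S)
    (fun a b => (a \notin S) && connect (fun u v => e u v && (v \notin S)) a b).
Proof.
move=> cS; split=> [a aS|a b c /andP[-> ab] bc cS'|a b c d].
- by rewrite aS connect0.
- by apply: connect_trans ab _; apply: connect1; rewrite bc.
move=> /andP[aS /connectP[s ps Eb]] ac bd /= cS' dS neq_cd; apply: contraT => ncd.
(* Steps may only lead out of [S] or to [d]. All vertices after the first are of this kind, so a
   path without chords for [r] has none for [e] either. *)
pose r := [rel u v | e u v && ((v \notin S) || (v == d))].
have rs : path r c (rcons (a :: s) d).
  rewrite rcons_path /= -Eb bd eqxx orbT andbT e_sym ac aS /=.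
  by rewrite andbT; apply: sub_path ps => u v /= /andP[-> ->].
have [s' [p' u' l' ch']] := chordless_path rs; rewrite last_rcons in l'.
have pe : path e c s' by apply: sub_path p' => u v /= /andP[].
have in_s' y : y \in s' -> (y \notin S) || (y == d).
  elim: s' (c) p' {u' l' ch' pe} => //= z s' IHs c0 /andP[/andP[_ Hz] /IHs H].
  by rewrite inE => /orP[/eqP ->|/H].
have ind : induced_path e c s'.
  split=> // i j lt_ij lt_j; have := ch' i j lt_ij lt_j; rewrite /= negb_and.
  case/orP=> //; case: j lt_ij lt_j => [//|j] _ lt_j /=.
  by rewrite in_s' ?mem_nth.
case: s' p' u' l' ch' pe in_s' ind => [|y [|z s']] p' u' l' ch' pe in_s' ind.
- by rewrite -l' /= eqxx in neq_cd.
- by case/negP: ncd; rewrite -l'; case/andP: pe.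
have yS : y \in S by apply: (cS _ _ ind) => //; rewrite ?l' // !inE eqxx orbT.
have := in_s' y; rewrite mem_head yS => /(_ isT) /eqP Ey.
by move: u'; rewrite /= => /and3P[_]; rewrite Ey -l' /= mem_last.
Qed.

End ConvexityCertificates.

(** * Membership in NP *)

Definition Imp (f g : form) : form := Not (And f (Not g)).
Definition All (t : term) (f : form) : form := Not (Ex t (Not f)).

Section Reflection.

Variable wd : bool -> word.

Lemma evalF_notP r f P : reflect P (evalF wd r f) -> reflect (~ P) (evalF wd r (Not f)).
Proof. by move=> H; apply: (iffP negP) => N /H /N. Qed.

Lemma evalF_andP r f g P Q : reflect P (evalF wd r f) -> reflect Q (evalF wd r g) ->
  reflect (P /\ Q) (evalF wd r (And f g)).
Proof. by move=> Hf Hg; apply: (iffP andP) => -[/Hf ? /Hg ?]. Qed.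

Lemma evalF_orP r f g P Q : reflect P (evalF wd r f) -> reflect Q (evalF wd r g) ->
  reflect (P \/ Q) (evalF wd r (Or f g)).
Proof.
move=> Hf Hg; rewrite evalF_Or; apply: (iffP orP) => -[].
1,3: by move/Hf; left.
all: by move/Hg; right.
Qed.

Lemma evalF_impP r f g (P Q : Prop) : reflect P (evalF wd r f) -> reflect Q (evalF wd r g) ->
  reflect (P -> Q) (evalF wd r (Imp f g)).
Proof.
move=> Hf Hg; rewrite /= negb_and negbK -implybE.
by apply: (iffP implyP) => H /Hf /H /Hg.
Qed.

(* The bound is equated separately, so that [apply] need not invert [evalT]. *)
Lemma evalF_exP r t b f (P : nat -> Prop) : evalT wd r t = b ->
  (forall v, reflect (P v) (evalF wd (rcons r v) f)) ->
  reflect (exists2 v, v < b & P v) (evalF wd r (Ex t f)).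
Proof.
move=> <- H; apply: (iffP hasP) => -[v lt_v /H Pv]; exists v => //.
  by move: lt_v; rewrite mem_iota.
by rewrite mem_iota.
Qed.

Lemma evalF_allP r t b f (P : nat -> Prop) : evalT wd r t = b ->
  (forall v, reflect (P v) (evalF wd (rcons r v) f)) ->
  reflect (forall v, v < b -> P v) (evalF wd r (All t f)).
Proof.
move=> Eb H; have H' v : reflect (~ P v) (evalF wd (rcons r v) (Not f)) := evalF_notP (H v).
apply: (iffP (evalF_notP (evalF_exP Eb H'))).
  by move=> N v lt_v; apply/H; apply: contraT => /H Nv; case: N; exists v.
by move=> A [v lt_v]; apply; apply: A.
Qed.

End Reflection.

Section Verifier.

(* [x] should be the encoding of a graph with [n] vertices and of a number whose
   leading binary digit has index [m]. The certificate [u] describes [n] sets, of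
   which the [i]-th one is used if [i < p], the convexity certificates of these
   sets, and the relation [j < p %/ 2 ^ i]. *)
Definition edge_bit (x : word) n a b := nth false x (n + 1 + a * n + b).
Definition digit (x : word) n i := nth false x (n + 1 + n * n + i).
Definition set_bit (u : word) n i a := nth false u (i * n + a).
Definition label_bit (u : word) n i a b := nth false u (n * n + ((i * n + a) * n + b)).
Definition less_bit (u : word) n i j := nth false u (n * n + n * (n * n) + (i * n + j)).

Definition well_formed (x : word) (n m : nat) : Prop :=
  0 < n /\ size x = n + 1 + n * n + (m + 1) /\
  (forall v, v < n -> nth false x v) /\ ~ nth false x n /\ digit x n m /\
  (1 < m \/ m = 1 /\ digit x n 0) /\
  (forall a, a < n -> ~ edge_bit x n a a /\
    forall b, b < n -> edge_bit x n a b -> edge_bit x n b a).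

(** With [q] the next quotient and [d] the digit, [2h < 2q + d] means [h < q], or [h <= q] if [d] is
    1, and [2h + 1 < 2q + d] means [h < q]. As only [h < q] is available, [h <= q] becomes [h = 0]
    or [h - 1 < q]. A single implication suffices: no index beyond [p] may be accepted. *)
Definition certifies_less (x u : word) (n m : nat) : Prop :=
  (forall j, j < n -> ~ less_bit u n (m + 1) j) /\
  (forall i, i < m + 1 -> forall j, j < n -> less_bit u n i j ->
    exists2 h, h < n &
      j = h + h /\ (less_bit u n (i + 1) h \/
        digit x n i /\ (h = 0 \/ exists2 g, g < n & h = g + 1 /\ less_bit u n (i + 1) g)) \/
      j = h + h + 1 /\ less_bit u n (i + 1) h).

Definition certifies_convex (x u : word) (n i : nat) : Prop :=
  (forall a, a < n -> ~ set_bit u n i a -> label_bit u n i a a) /\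
  (forall a, a < n -> forall b, b < n -> label_bit u n i a b -> forall c, c < n ->
     (edge_bit x n b c -> ~ set_bit u n i c -> label_bit u n i a c) /\
     forall d, d < n -> edge_bit x n a c -> edge_bit x n b d -> set_bit u n i c ->
       set_bit u n i d -> ~ c = d -> edge_bit x n c d).

Definition certifies (x u : word) (n m : nat) : Prop :=
  well_formed x n m /\ certifies_less x u n m /\
  (forall a, a < n -> exists2 i, i < n & less_bit u n 0 i /\ set_bit u n i a) /\
  (forall i, i < n -> (exists2 a, a < n & ~ set_bit u n i a) /\ certifies_convex x u n i).

Let n_ := Var 0.
Let m_ := Var 1.

Definition edge_form a b :=
  Bit false (Add (Add (Add n_ (Cst 1)) (Mul a n_)) b).
Definition digit_form i := Bit false (Add (Add (Add n_ (Cst 1)) (Mul n_ n_)) i).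
Definition set_form i a := Bit true (Add (Mul i n_) a).
Definition label_form i a b :=
  Bit true (Add (Mul n_ n_) (Add (Mul (Add (Mul i n_) a) n_) b)).
Definition less_form i j :=
  Bit true (Add (Add (Mul n_ n_) (Mul n_ (Mul n_ n_))) (Add (Mul i n_) j)).

Definition well_formed_form : form :=
  And (Lt (Cst 0) n_)
  (And (Eq (Len false) (Add (Add (Add n_ (Cst 1)) (Mul n_ n_)) (Add m_ (Cst 1))))
  (And (All n_ (Bit false (Var 2)))
  (And (Not (Bit false n_))
  (And (digit_form m_)
  (And (Or (Lt (Cst 1) m_) (And (Eq m_ (Cst 1)) (digit_form (Cst 0))))
       (All n_ (And (Not (edge_form (Var 2) (Var 2)))
         (All n_ (Imp (edge_form (Var 2) (Var 3)) (edge_form (Var 3) (Var 2))))))))))).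

Definition certifies_less_form : form :=
  And (All n_ (Not (less_form (Add m_ (Cst 1)) (Var 2))))
  (All (Add m_ (Cst 1)) (All n_ (Imp (less_form (Var 2) (Var 3))
    (Ex n_ (Or
      (And (Eq (Var 3) (Add (Var 4) (Var 4)))
           (Or (less_form (Add (Var 2) (Cst 1)) (Var 4))
               (And (digit_form (Var 2))
                 (Or (Eq (Var 4) (Cst 0))
                     (Ex n_ (And (Eq (Var 4) (Add (Var 5) (Cst 1)))
                                 (less_form (Add (Var 2) (Cst 1)) (Var 5))))))))
      (And (Eq (Var 3) (Add (Add (Var 4) (Var 4)) (Cst 1)))
           (less_form (Add (Var 2) (Cst 1)) (Var 4)))))))).

Definition certifies_convex_form : form :=
  let i := Var 2 in
  And (All n_ (Imp (Not (set_form i (Var 3))) (label_form i (Var 3) (Var 3))))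
  (All n_ (All n_ (Imp (label_form i (Var 3) (Var 4)) (All n_
    (And (Imp (edge_form (Var 4) (Var 5))
           (Imp (Not (set_form i (Var 5))) (label_form i (Var 3) (Var 5))))
    (All n_ (Imp (edge_form (Var 3) (Var 5)) (Imp (edge_form (Var 4) (Var 6))
       (Imp (set_form i (Var 5)) (Imp (set_form i (Var 6))
       (Imp (Not (Eq (Var 5) (Var 6))) (edge_form (Var 5) (Var 6))))))))))))).

Definition certifies_form : form :=
  And well_formed_form (And certifies_less_form
  (And (All n_ (Ex n_ (And (less_form (Cst 0) (Var 3)) (set_form (Var 3) (Var 2)))))
       (All n_ (And (Ex n_ (Not (set_form (Var 2) (Var 3)))) certifies_convex_form)))).

Definition verifier : form :=
  Ex (Add (Len false) (Cst 1)) (Ex (Add (Len false) (Cst 1)) certifies_form).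

Ltac reflect_form :=
  repeat first
    [ apply: evalF_allP => [//|?] | apply: evalF_exP => [//|?] | apply: evalF_impP
    | apply: evalF_andP | apply: evalF_orP | apply: evalF_notP
    | exact: idP | exact: eqP ].

Lemma verifierP x u : reflect
  (exists2 n, n < size x + 1 & exists2 m, m < size x + 1 & certifies x u n m)
  (evalF (pair_of_words x u) [::] verifier).
Proof.
rewrite /verifier /certifies_form /well_formed_form /certifies_less_form /certifies_convex_form.
rewrite /certifies /well_formed /certifies_less /certifies_convex.
reflect_form.
Qed.

End Verifier.

Lemma size_binary p : size (binary p) = (trunc_log 2 p).+1.
Proof. by rewrite size_mkseq. Qed.

Lemma binary_cons (c : bool) p : 0 < p -> binary (c + p.*2) = c :: binary p.
Proof.
move=> p_gt0; have half_p : (c + p.*2)./2 = p by rewrite half_bit_double.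
have c_gt1 : 1 < c + p.*2 by rewrite -addnn; case: c {half_p}; lia.
apply: (@eq_from_nth _ false) => [|i _].
  by rewrite -[RHS]/((size (binary p)).+1) !size_binary trunc_log2S // half_p.
rewrite nth_binary; last exact: ltnW.
case: i => [|i] /=; first by rewrite expn0 divn1 oddD odd_double addbF oddb.
by rewrite nth_binary // expnS divnMA divn2 half_p.
Qed.

Lemma binary_surj (b : word) : last false b -> exists2 p, 0 < p & binary p = b.
Proof.
elim: b => [//|c [|d b] IHb] /=.
  by case: c => // _; exists 1.
by move=> /IHb[p p_gt0 Eb]; exists (c + p.*2); [lia | rewrite binary_cons // Eb].
Qed.

Section Encoding.

Variables (n : nat) (e : rel 'I_n) (p : nat).

Lemma nth_encode_unary i : i < n -> nth false (encode e p) i = true.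
Proof. by move=> lt_i; rewrite nth_cat size_nseq lt_i nth_nseq lt_i. Qed.

Lemma nth_encode_separator : nth false (encode e p) n = false.
Proof. by rewrite nth_cat size_nseq ltnn subnn. Qed.

Lemma size_encode : size (encode e p) = n + 1 + n * n + (trunc_log 2 p).+1.
Proof.
by rewrite size_cat size_nseq /= size_cat size_allpairs size_enum_ord size_binary; lia.
Qed.

Lemma nth_encode_binary i : 0 < p -> digit (encode e p) n i = odd (p %/ 2 ^ i).
Proof.
move=> p_gt0; rewrite /digit nth_cat size_nseq ifN; last by lia.
rewrite (_ : n + 1 + n * n + i - n = (n * n + i).+1) /=; last by lia.
by rewrite nth_cat size_allpairs size_enum_ord ifN ?addKn ?nth_binary //; lia.
Qed.

Lemma nth_encode_edge (a b : 'I_n) : edge_bit (encode e p) n a b = e a b.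
Proof.
have lt_a := ltn_ord a; have lt_b := ltn_ord b.
have lt_ab : a * n + b < n * n by nia.
rewrite /edge_bit nth_cat size_nseq ifN; last by lia.
rewrite (_ : n + 1 + a * n + b - n = (a * n + b).+1) /=; last by lia.
rewrite nth_cat size_allpairs size_enum_ord lt_ab.
have gen s k (i : 'I_n) : nth i s k = i -> k < size s ->
    nth false [seq e i j | i <- s, j <- enum 'I_n] (k * n + b) = e i b.
  elim: s k => [//|c s IHs] [|k] /= Ek lt_k.
    rewrite nth_cat size_map size_enum_ord lt_b (nth_map b) ?size_enum_ord //.
    by rewrite nth_ord_enum Ek.
  rewrite nth_cat size_map size_enum_ord ifN; last by nia.
  by rewrite (_ : k.+1 * n + b - n = k * n + b) ?IHs //; lia.
by apply: gen; rewrite ?size_enum_ord // nth_ord_enum.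
Qed.

End Encoding.

(** * An accepted certificate yields a cover *)

Section Soundness.

Variables (x u : word) (n m : nat).
Hypothesis cert : certifies x u n m.

Let edge (a b : 'I_n) : bool := edge_bit x n a b.

Lemma well_formed_encode : exists2 p, 3 <= p & x = encode edge p.
Proof.
have [[n_gt0 [size_x [unary [sep [top [three sym]]]]]] _] := cert.
have [p p_gt0 Ep] : exists2 p, 0 < p & binary p = drop (n + 1 + n * n) x.
  apply: binary_surj; rewrite -nth_last nth_drop size_drop size_x.
  by rewrite (_ : _ + (_ - _).-1 = n + 1 + n * n + m) //; lia.
have size_p : (trunc_log 2 p).+1 = m + 1.
  by rewrite -size_binary Ep size_drop size_x; lia.
exists p.
  (* A leading index above 1 means [p >= 4]; index 1 together with an odd last digit means
     [p = 3]. *)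
  case: three => [lt1m|[m1 d0]].
    have := trunc_logP (isT : 1 < 2) p_gt0; apply: leq_trans.
    by apply: (@leq_trans (2 ^ 2)) => //; rewrite leq_exp2l //; lia.
  have := trunc_logP (isT : 1 < 2) p_gt0; rewrite (_ : trunc_log 2 p = 1); last by lia.
  have : odd p.
    have := nth_binary 0 p_gt0; rewrite Ep nth_drop expn0 divn1 => <-; exact: d0.
  by case: p {p_gt0 Ep size_p} => [|[|[|p]]].
apply: (@eq_from_nth _ false) => [|i]; first by rewrite size_encode size_x size_p.
rewrite size_x => lt_i; case: (ltngtP i n) => [lt_in|gt_in|->].
- by rewrite nth_encode_unary // unary.
- case: (ltnP i (n + 1 + n * n)) => [lt_m|ge_m].
    have Ei : i = n + 1 + ((i - n.+1) %/ n) * n + (i - n.+1) %% n.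
      by rewrite -addnA -divn_eq; lia.
    have lt_a : (i - n.+1) %/ n < n by rewrite ltn_divLR //; lia.
    have lt_b : (i - n.+1) %% n < n by rewrite ltn_mod.
    by rewrite Ei; have /= := nth_encode_edge edge p (Ordinal lt_a) (Ordinal lt_b).
  have Ei : i = n + 1 + n * n + (i - (n + 1 + n * n)) by rewrite subnKC.
  have := nth_encode_binary edge (i - (n + 1 + n * n)) p_gt0; rewrite /digit -Ei => ->.
  by rewrite -nth_binary // Ep nth_drop -Ei.
- by rewrite nth_encode_separator; apply/negP.
Qed.

Lemma certifies_sound : m_convex_cover_problem x.
Proof.
have [p p_ge3 Ex] := well_formed_encode.
have [[n_gt0 [size_x [_ [_ [_ [_ sym]]]]]] [[less_top less_step] [cover sets]]] := cert.
have p_gt0 : 0 < p by apply: leq_trans p_ge3.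
have size_p : trunc_log 2 p = m by move: size_x; rewrite Ex size_encode; lia.
exists n, edge, p; split=> //.
- move=> a b; apply/idP/idP; [apply: (sym a _).2 | apply: (sym b _).2] => //.
- by move=> a; apply/negbTE/negP; apply: (sym a _).1.
have digitE i : digit x n i = odd (p %/ 2 ^ i) by rewrite Ex nth_encode_binary.
(* Induction from the top row [m + 1], where the quotient is 0, down to row 0, where it is [p]. *)
have less_lt k i j : i + k = m + 1 -> j < n -> less_bit u n i j -> j < p %/ 2 ^ i.
  elim: k i j => [|k IHk] i j Ei lt_j.
    by rewrite addn0 in Ei; subst i => /(less_top _ lt_j).
  move=> /(less_step i ltac:(lia) j lt_j)[h lt_h].
  have Ep : p %/ 2 ^ i = odd (p %/ 2 ^ i) + 2 * (p %/ 2 ^ (i + 1)).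
    by rewrite addn1 expnSr divnMA divn2 mul2n odd_double_half.
  have IH g : g < n -> less_bit u n (i + 1) g -> g < p %/ 2 ^ (i + 1).
    by move=> lt_g; apply: IHk => //; lia.
  rewrite digitE in Ep *.
  move=> [[-> [/(IH _ lt_h)|[di [->|[g lt_g [-> /(IH _ lt_g)]]]]]]|[-> /(IH _ lt_h)]].
  - by rewrite Ep; move: (p %/ _) (odd _) => ? ?; lia.
  - by rewrite Ep di.
  - by rewrite Ep di /=; move: (p %/ _) => ?; lia.
  - by rewrite Ep; move: (p %/ _) (odd _) => ? ?; lia.
have less0 i : i < n -> less_bit u n 0 i -> i < p.
  by move=> lt_i /(@less_lt (m + 1) 0 i erefl lt_i); rewrite expn0 divn1.
pose V (i : 'I_p) : {set 'I_n} := if i < n then [set a : 'I_n | set_bit u n i a] else set0.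
exists V; split=> [i|i|].
- rewrite /V; case: ltnP => [lt_i|_]; last by move=> y s _; rewrite inE.
  have [_ [C1 C23]] := sets i lt_i.
  apply: (@certificate_m_convex _ edge _ _ (fun a b : 'I_n => label_bit u n i a b)).
  + move=> a b; apply/idP/idP; [apply: (sym a _).2 | apply: (sym b _).2] => //.
  split=> [a|a b c lab bc|a b c d lab ac bd]; rewrite /= !inE.
  + by move/negP; apply: C1.
  + move/negP; have [+ _] := C23 a (ltn_ord a) b (ltn_ord b) lab c (ltn_ord c); exact.
  + move=> cS dS neq_cd; have [_ H] := C23 a (ltn_ord a) b (ltn_ord b) lab c (ltn_ord c).
    by apply: (H d) => // E; case/eqP: neq_cd; apply: ord_inj.
- rewrite /V; apply/eqP => /setP E; case: ltnP E => [lt_i|_] E; last first.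
    by have := E (Ordinal n_gt0); rewrite !inE.
  have [[a lt_a na] _] := sets i lt_i.
  by have := E (Ordinal lt_a); rewrite !inE => /na.
- apply/setP => a; rewrite inE; apply/bigcupP.
  have [i lt_i [less_i ai]] := cover a (ltn_ord a).
  by exists (Ordinal (less0 i lt_i less_i)); rewrite // /V /= lt_i inE.
Qed.

End Soundness.

(** * A cover yields an accepted certificate *)

Section Completeness.

Variables (n : nat) (e : rel 'I_n) (p : nat).
Hypotheses (e_sym : symmetric e) (e_irr : irreflexive e) (p_ge3 : 3 <= p).
Hypothesis n_gt0 : 0 < n.

Let m := trunc_log 2 p.

(* At most [n] of the sets are needed: one for each vertex. *)
Lemma small_cover : has_m_convex_cover e p ->
  exists W : nat -> {set 'I_n}, [/\ forall i, m_convex e (W i), forall i, W i != [set: 'I_n]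
    & forall a, exists2 i, i < n & i < p /\ a \in W i].
Proof.
move=> [V [cV pV covV]].
have inV a : exists i, a \in V i.
  by have : a \in \bigcup_(i < p) V i; [rewrite covV inE | case/bigcupP => i; exists i].
(* For [p < n] the given sets are padded with empty ones; otherwise the [i]-th set is chosen to
   contain vertex [i], whose index is automatically below [p]. *)
pose W i : {set 'I_n} := if p < n then (if insub i is Some i' then V i' else set0)
  else (if insub i is Some a then V (xchoose (inV a)) else set0).
have c0 : m_convex e set0 by move=> y s _; rewrite inE.
have p0 : (set0 : {set 'I_n}) != [set: 'I_n].
  by apply/eqP => /setP /(_ (Ordinal n_gt0)); rewrite !inE.
exists W; split=> [i|i|a].
- by rewrite /W; case: ifP => _; case: insubP => // *; apply: cV.
- by rewrite /W; case: ifP => _; case: insubP => // *; apply: pV.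
case: (ltnP p n) => [lt_pn|le_np].
  have [i ai] := inV a; have lt_i := ltn_ord i.
  exists i; [exact: ltn_trans lt_pn | split=> //].
  by rewrite /W lt_pn valK.
exists a => //; split; first exact: leq_trans le_np.
by rewrite /W ltnNge le_np valK; apply: (xchooseP (inV a)).
Qed.

Variable W : nat -> {set 'I_n}.
Hypotheses (cW : forall i, m_convex e (W i)) (pW : forall i, W i != [set: 'I_n]).
Hypothesis covW : forall a, exists2 i, i < n & i < p /\ a \in W i.

Let label i (a b : 'I_n) :=
  (a \notin W i) && connect (fun y z => e y z && (z \notin W i)) a b.

Let vertex_at (P : pred 'I_n) (a : nat) : bool := [exists c : 'I_n, (c == a :> nat) && P c].

Let vertex_atE (P : pred 'I_n) (a : 'I_n) : vertex_at P a = P a.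
Proof.
apply/existsP/idP => [[c /andP[/eqP/ord_inj ->]] //|Pa].
by exists a; rewrite eqxx.
Qed.

(** Three blocks: [n] sets, [n] relations, and [m + 2] rows of comparisons, the last of which, for
    the quotient 0, is all false. *)
Definition certificate_size := n * n + n * (n * n) + (m + 2) * n.

Definition certificate : word := mkseq (fun k =>
  let l := k - n * n in let t := l - n * (n * n) in
  if k < n * n then vertex_at (fun a => a \in W (k %/ n)) (k %% n)
  else if l < n * (n * n) then
    vertex_at (fun a => vertex_at (label (l %/ n %/ n) a) (l %% n)) (l %/ n %% n)
  else t %% n < p %/ 2 ^ (t %/ n)) certificate_size.

Lemma set_bit_certificate i (a : 'I_n) : i < n -> set_bit certificate n i a = (a \in W i).
Proof.
move=> lt_i; have lt_a := ltn_ord a.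
have lt_k : i * n + a < n * n by nia.
rewrite /set_bit nth_mkseq; last by rewrite /certificate_size; lia.
by rewrite lt_k divnMDl // divn_small // addn0 modnMDl modn_small // vertex_atE.
Qed.

Lemma label_bit_certificate i (a b : 'I_n) : i < n ->
  label_bit certificate n i a b = label i a b.
Proof.
move=> lt_i; have lt_a := ltn_ord a; have lt_b := ltn_ord b.
have lt_k : i * n + a < n * n by nia.
have lt_l : (i * n + a) * n + b < n * (n * n) by nia.
rewrite /label_bit nth_mkseq; last by rewrite /certificate_size; lia.
rewrite ltnNge leq_addr /= addKn lt_l divnMDl // [b %/ n]divn_small // addn0.
by rewrite divnMDl // [a %/ n]divn_small // addn0 !modnMDl !modn_small // !vertex_atE.
Qed.

Lemma less_bit_certificate i j : i < m + 2 -> j < n ->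
  less_bit certificate n i j = (j < p %/ 2 ^ i).
Proof.
move=> lt_i lt_j; have lt_k : i * n + j < (m + 2) * n by nia.
rewrite /less_bit nth_mkseq; last by rewrite /certificate_size; lia.
cbv zeta; rewrite ifN; last by lia.
rewrite ifN; last by lia.
rewrite (_ : _ - _ - _ = i * n + j); last by lia.
by rewrite modnMDl modn_small // divnMDl // [j %/ n]divn_small // addn0.
Qed.

Lemma forall_ord (P : nat -> Prop) : (forall a : 'I_n, P a) -> forall a, a < n -> P a.
Proof. by move=> H a lt_a; apply: (H (Ordinal lt_a)). Qed.

Lemma certificate_certifies : certifies (encode e p) certificate n m.
Proof.
have p_gt0 : 0 < p by apply: leq_trans p_ge3.
have m_gt0 : 0 < m by rewrite trunc_log_gt0 /=; apply: ltn_trans p_ge3.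
split; last split; last split.
- split=> //; split; first by rewrite size_encode [m + 1]addn1.
  split; first by move=> v lt_v; rewrite nth_encode_unary.
  split; first by rewrite nth_encode_separator.
  split.
    rewrite nth_encode_binary //; have := trunc_log_bounds (isT : 1 < 2) p_gt0.
    rewrite -/m => /andP[le1 lt2]; rewrite (_ : p %/ 2 ^ m = 1) //.
    apply/eqP; rewrite eqn_leq -ltnS ltn_divLR ?expn_gt0 // -expnS lt2.
    by rewrite divn_gt0 ?expn_gt0.
  split.
    case: (ltngtP 1 m) => [lt1|gt1|Em]; [by left|by rewrite ltnNge m_gt0 in gt1|right].
    split=> //; rewrite nth_encode_binary // expn0 divn1.
    have := trunc_log_ltn p (isT : 1 < 2); rewrite -/m -Em.
    by case: (p) p_ge3 => [|[|[|[|q]]]].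
  apply: forall_ord => a; rewrite nth_encode_edge e_irr; split=> //.
  by apply: forall_ord => b; rewrite !nth_encode_edge e_sym.
- split=> [j lt_j|i lt_i j lt_j].
    rewrite less_bit_certificate //; last by lia.
    by rewrite divn_small // addn1; apply: trunc_log_ltn.
  rewrite less_bit_certificate //; last by lia.
  have Ep : p %/ 2 ^ i = odd (p %/ 2 ^ i) + 2 * (p %/ 2 ^ (i + 1)).
    by rewrite addn1 expnSr divnMA divn2 mul2n odd_double_half.
  move: Ep; set d := odd _; set q := p %/ 2 ^ (i + 1) => -> lt_jq.
  have less h : h < n -> less_bit certificate n (i + 1) h = (h < q).
    by move=> lt_h; rewrite less_bit_certificate //; lia.
  have lt_h : j./2 < n by apply: leq_ltn_trans lt_j; rewrite -divn2 leq_div.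
  have Ej : j = odd j + (j./2 + j./2) by rewrite addnn odd_double_half.
  (* The witness is the half of [j]; its parity selects the case of the recurrence. *)
  exists j./2 => //; rewrite nth_encode_binary // -/d less //.
  case: (odd j) Ej => Ej; [right|left].
    by split; [lia | move: lt_jq; case: (d); lia].
  split; first by lia.
  case: (ltnP j./2 q) => [|ge_h]; [by left | right].
  split; first by move: lt_jq; case: (d) => //; lia.
  case Eh: j./2 => [|h]; [by left | right]; exists h; first by lia.
  by split; [lia | rewrite less; move: lt_jq; case: (d); lia].
- apply: forall_ord => a; have [i lt_i [lt_ip ai]] := covW a; exists i => //.
  rewrite less_bit_certificate //; last by lia.
  by rewrite expn0 divn1 set_bit_certificate.
move=> i lt_i; split.
  have := pW i; rewrite -subTset => /subsetPn[a _ na]; exists a => //.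
  by rewrite set_bit_certificate //; apply/negP.
have [C1 C2 C3] := m_convex_certificate e_sym (@cW i).
split.
  apply: forall_ord => a; rewrite set_bit_certificate // label_bit_certificate // => /negP.
  exact: C1.
apply: forall_ord => a; apply: forall_ord => b; rewrite label_bit_certificate // => lab.
apply: forall_ord => c; split.
  rewrite nth_encode_edge set_bit_certificate // label_bit_certificate // => bc /negP.
  exact: C2 lab bc.
apply: forall_ord => d; rewrite !nth_encode_edge !set_bit_certificate // => ac bd cS dS neq.
by apply: (C3 a b) => //; apply: contra_not_neq neq => ->.
Qed.

End Completeness.

Theorem m_convex_cover_in_NP : in_NP m_convex_cover_problem.
Proof.
exists (fun x u => evalF (pair_of_words x u) [::] verifier); first exact: form_polytime.
(* The size of the certificate, with both [n] and the index of the leading digit replaced by the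
   length of the input. *)
have [r Hr] : is_polynomial (fun X => X * X + X * (X * X) + (X + 2) * X) by poly.
exists r => x.
split=> [[n [e [p [e_sym e_irr p_ge3 -> cov]]]]|[u _ /verifierP[n _ [m _]]]]; last first.
  exact: certifies_sound.
(* A graph without vertices has no proper subset, whereas a cover must supply at least three. *)
have n_gt0 : 0 < n.
  case: n e e_sym e_irr cov => // e _ _ [V [_ pV _]].
  have /eqP[] := pV (Ordinal (ltn_trans (isT : 0 < 2) p_ge3)).
  by apply/setP => -[].
have [W [cW pW covW]] := small_cover n_gt0 cov.
set x0 := encode e p; have size_x : size x0 = n + 1 + n * n + (trunc_log 2 p).+1.
  exact: size_encode.
exists (certificate e p W).
  rewrite -Hr size_mkseq /certificate_size -/x0.
  have le_n : n <= size x0 by lia.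
  have le_m : trunc_log 2 p <= size x0 by lia.
  by rewrite !leq_add ?leq_mul ?leq_add.
apply/verifierP; exists n; first by rewrite -/x0 size_x; lia.
exists (trunc_log 2 p); first by rewrite -/x0 size_x; lia.
exact: certificate_certifies.
Qed.

Theorem theorem13 : NP_complete m_convex_cover_problem.
Proof. by split; [apply: m_convex_cover_in_NP | apply: m_convex_cover_hard]. Qed.
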